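(* Let $U,V,W\subset\mathbb{C}$ be nonempty compact sets. If the triple $(U,V,W)$ is compatible, then every $B_+\in M_+(U,V,W)$ is Fredholm and at least one of the non-negative integers $\alpha(B_+)$ and $\beta(B_+)$ is zero.
   Context: $\mathbb{N}=\{1,2,\dots\}$. $M(U,V,W)$ is the set of bi-infinite tridiagonal matrices $A=(a_{ij})_{i,j\in\mathbb{Z}}$ with $a_{i,i-1}\in U$, $a_{i,i}\in V$, $a_{i,i+1}\in W$ for all $i$, all other entries zero. $M_+(U,V,W)$ is the set of semi-infinite tridiagonal matrices $(a_{ij})_{i,j\in\mathbb{N}}$ with subdiagonal entries in $U$, diagonal entries in $V$, superdiagonal entries in $W$, all other entries zero. $M_n(U,V,W)$ is the set of $n\times n$ matrices of the same kind, and $M_{\rm fin}(U,V,W)=\bigcup_{n\in\mathbb{N}}M_n(U,V,W)$. Matrices in $M(U,V,W)$, $M_+(U,V,W)$ act as bounded operators on $\ell^p(\mathbb{Z})$, $\ell^p(\mathbb{N})$, respectively, where $p\in[1,\infty]$; their invertibility, Fredholmness and (if Fredholm) index do not depend on $p$. $A\in M(U,V,W)$ is pseudoergodic, $A\in \Psi E(U,V,W)$, if for every $n\in\mathbb N$, every $B\in M_n(U,V,W)$ and every $\varepsilon>0$ there is a submatrix $C$ of $A$ composed of rows and columns $k+1,\dots,k+n$ of $A$, for some integer $k$, with $\|B-C\|<\varepsilon$. The set $\Psi E_+(U,V,W)\subset M_+(U,V,W)$ is defined in the same way for semi-infinite matrices. For a bounded operator $B$, $\alpha(B)$ is the dimension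 of its null space and $\beta(B)$ the codimension of its image; $B$ is Fredholm if both are finite. $(U,V,W)$ is called compatible if one (equivalently each) of the following conditions, known to be equivalent, holds: (i) one operator in $\Psi E(U,V,W)$ is Fredholm; (ii) one operator in $\Psi E(U,V,W)$ is invertible; (iii) all operators in $M(U,V,W)$ are Fredholm; (iv) all operators in $M(U,V,W)$ are invertible; (v) one operator in $\Psi E_+(U,V,W)$ is Fredholm; (vi) all operators in $M_+(U,V,W)$ are Fredholm. *)

(* Defs.v *)
From HB Require Import structures.
From mathcomp Require Import all_boot all_order all_algebra.
From mathcomp Require Import complex.
From mathcomp Require Import all_classical all_reals all_analysis.

Set Implicit Arguments.
Unset Strict Implicit.
Unset Printing Implicit Defensive.

Import Order.TTheory GRing.Theory Num.Theory.
Import numFieldNormedType.Exports.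

Local Open Scope classical_set_scope.
Local Open Scope complex_scope.
Local Open Scope ring_scope.

(* The type R[i] itself carries no topology in the library; its packaging as a
   numClosedFieldType does (the topology of the modulus). *)
Definition Cplx (R : realType) : numClosedFieldType := R[i].

(* The regular module ^o makes complex sequences an lmodType. *)
Notation cseq R I := (I -> (Cplx R)^o).

Section Dimension.
Variables (R : realType) (K : fieldType) (V : lmodType K).
Implicit Types X Y : set V.

Definition indep_mod Y (n : nat) (b : 'I_n -> V) : Prop :=
  forall c : 'I_n -> K, Y (\sum_(k < n) c k *: b k) -> forall k, c k = 0.

(* dim X / Y for subspaces Y of X, as an element of {0, 1, 2, ..., +oo}. *)
Definition dim_quot X Y : \bar R :=
  ereal_sup [set (n%:R)%:E | n in
    [set n : nat | exists2 b : 'I_n -> V, (forall k, X (b k)) & indep_mod Y b]].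

End Dimension.

Section Lp.
Variables (R : realType) (I : choiceType) (p : \bar R).
Implicit Types x y : cseq R I.

(* Only used for 1 <= p; the value for p = -oo is irrelevant. *)
Definition lp_norm x : \bar R :=
  match p with
  | r%:E => poweR (\esum_(i in [set: I]) (Normc.normc (x i) `^ r)%:E) r^-1
  | +oo%E => ereal_sup (range (fun i => (Normc.normc (x i))%:E))
  | -oo%E => 0%E
  end.

Definition lp : set (cseq R I) := [set x | (lp_norm x < +oo)%E].

(* Operators are total maps on sequences; only their restriction to lp matters. *)
Definition bounded_operator (T : cseq R I -> cseq R I) : Prop :=
  (forall (c : Cplx R) x y, lp x -> lp y -> T (c *: x + y) = c *: T x + T y) /\
  (exists M : R, forall x, lp x -> (lp_norm (T x) <= M%:E * lp_norm x)%E).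

Definition invertible (T : cseq R I -> cseq R I) : Prop :=
  exists2 S, bounded_operator S &
    forall x, lp x -> T (S x) = x /\ S (T x) = x.

Definition alpha (T : cseq R I -> cseq R I) : \bar R :=
  dim_quot R (lp `&` [set x | T x = 0]) [set 0].

Definition beta (T : cseq R I -> cseq R I) : \bar R :=
  dim_quot R lp (T @` lp).

Definition fredholm (T : cseq R I -> cseq R I) : Prop :=
  (alpha T < +oo)%E /\ (beta T < +oo)%E.

End Lp.

(* The sum is the finitely supported sum, which is 0 for infinite support; each
   row of a tridiagonal matrix has at most three nonzero entries. *)
Definition mxop (R : realType) (I : choiceType) (a : I -> I -> Cplx R)
    (x : cseq R I) : cseq R I :=
  fun i => \sum_(j \in [set: I]) a i j * x j.

Section Jacobi.
Variables (R : realType) (U V W : set (Cplx R)).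

(* [pos i] is the position, as an integer, of the index i. *)
Definition tridiagonal (I : Type) (pos : I -> int) (a : I -> I -> Cplx R) : Prop :=
  forall i j,
    [/\ pos j = pos i - 1 -> U (a i j),
        pos j = pos i -> V (a i j),
        pos j = pos i + 1 -> W (a i j) &
        (1 < `|pos i - pos j|) -> a i j = 0].

Definition M : set (int -> int -> Cplx R) :=
  [set a | tridiagonal id a].

(* Semi-infinite matrices are indexed from 0 rather than from 1. *)
Definition Mplus : set (nat -> nat -> Cplx R) :=
  [set a | tridiagonal Posz a].

Definition Mfin (n : nat) : set 'M[Cplx R]_n :=
  [set B | tridiagonal (fun i : 'I_n => (i : nat)%:Z) B].

(* The matrix norm is the library's entrywise maximum norm; since n is fixed
   before epsilon, any other norm on n x n matrices gives the same notion. *)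
Definition PsiE : set (int -> int -> Cplx R) :=
  [set a | M a /\
    forall (n : nat) (B : 'M[Cplx R]_n) (eps : R), (0 < n)%N -> Mfin B -> 0 < eps ->
      exists k : int,
        mx_norm (B - \matrix_(i < n, j < n) a (k + 1 + i%:Z) (k + 1 + j%:Z))
          < eps%:C].

Definition PsiEplus : set (nat -> nat -> Cplx R) :=
  [set a | Mplus a /\
    forall (n : nat) (B : 'M[Cplx R]_n) (eps : R), (0 < n)%N -> Mfin B -> 0 < eps ->
      exists k : nat,
        mx_norm (B - \matrix_(i < n, j < n) a (k + i)%N (k + j)%N) < eps%:C].

Definition compatible (p : \bar R) : Prop :=
  [\/ exists2 a, PsiE a & fredholm p (mxop a),
      exists2 a, PsiE a & invertible p (mxop a),
      forall a, M a -> fredholm p (mxop a) |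
      [\/ forall a, M a -> invertible p (mxop a),
          exists2 a, PsiEplus a & fredholm p (mxop a) |
          forall a, Mplus a -> fredholm p (mxop a)]].

End Jacobi.

(* Main.v *)
(* Let B be a half-line matrix, and suppose that B and its transpose have nonzero
   null vectors x and y, decaying at infinity.  Put B on the sites >= 1, its
   reflected transpose on the sites <= -1, and couple both to the site 0.  The
   vector equal to s times the reflection of y on the left, to 0 at the site 0 and
   to t times x on the right is annihilated at every site except possibly 0, and
   the ratio of s and t can be chosen so that it is annihilated there too.  This
   contradicts the invertibility of all bi-infinite matrices over (U, V, W).
   There is no need for duality: if A extends B, the null vector y of the
   transpose of B is a row of the inverse of A, and it decays because the columns
   of the inverse do, uniformly.

   Invertibility of every A over (U, V, W) is derived from the Fredholmness of any
   operator T with infinitely many windows close to each window of A.  If the kernel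
   and cokernel of T have dimension at most N, then N + 1 copies of a vector in
   far apart windows are dependent modulo the kernel (or the image) of T, and a
   dependence relation is seen from one of these windows as a lower bound for A
   (or as a solution of A x = y), with constants coming from the open mapping
   theorem for T.  Diagonal limits then give all of l^p. *)

Require Import Defs.
From mathcomp Require Import all_boot all_order all_algebra.
From mathcomp Require Import complex.
From mathcomp Require Import all_classical all_reals all_analysis.
From mathcomp Require Import ring lra zify.
Import Order.TTheory GRing.Theory Num.Theory.
Import numFieldNormedType.Exports.
Local Open Scope classical_set_scope.
Local Open Scope ring_scope.

Set Implicit Arguments.
Unset Strict Implicit.
Unset Printing Implicit Defensive.

(** * Moduli and lp norms *)

Section Modulus.
Variable R : realType.
Implicit Types z w : Cplx R.

Definition nc z : R := Normc.normc z.

Lemma ncD z w : nc (z + w) <= nc z + nc w.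
Proof. exact: le_normcD. Qed.

Lemma ncN z : nc (- z) = nc z.
Proof. exact: normcN. Qed.

Lemma ncM z w : nc (z * w) = nc z * nc w.
Proof. exact: Normc.normcM. Qed.

Lemma ncE z : `|z| = ((nc z)%:C)%C :> Cplx R.
Proof. by case: z. Qed.

Lemma nc_ge0 z : 0 <= nc z.
Proof. by case: z => a b; rewrite /nc /= sqrtr_ge0. Qed.

Lemma nc0 : nc 0 = 0.
Proof. exact: Normc.normc0. Qed.

Lemma nc1 : nc 1 = 1.
Proof. exact: Normc.normc1. Qed.

Lemma nc_eq0 z : (nc z == 0) = (z == 0).
Proof.
apply/eqP/eqP => [|->]; last exact: nc0.
exact: Normc.eq0_normc.
Qed.

Lemma ncV z : nc z^-1 = (nc z)^-1.
Proof. exact: Normc.normcV. Qed.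

Lemma nc_real (r : R) : nc (r%:C)%C = `|r|.
Proof. by rewrite /nc /= expr0n /= addr0 sqrtr_sqr. Qed.

Lemma nc_sum (I : Type) (s : seq I) (P : pred I) (F : I -> Cplx R) :
  nc (\sum_(i <- s | P i) F i) <= \sum_(i <- s | P i) nc (F i).
Proof.
elim/big_rec2: _ => [|i x y _ h]; first by rewrite nc0.
by apply: le_trans (ncD _ _) _; rewrite lerD2l.
Qed.

End Modulus.

Section Norm.
Variables (R : realType) (p : \bar R).
Hypothesis hp : (1 <= p)%E.

(** A real bound instead of the norm itself: it expresses membership in l^p and size at once, and
    keeps estimates out of the extended reals. *)
Definition nle (I : choiceType) (x : cseq R I) (M : R) := (lp_norm p x <= M%:E)%E.

(** The infinite sum is a supremum over finite sets and [r]-th powers are monotone, so for a finite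
    exponent norm estimates reduce to finite sums. *)
Lemma nleP_fin (I : choiceType) (r : R) (x : cseq R I) (M : R) : 1 <= r -> 0 <= M ->
  (lp_norm r%:E x <= M%:E)%E <->
  forall s, uniq s -> \sum_(i <- s) nc (x i) `^ r <= M `^ r.
Proof.
move=> r1 M0; have r0 : 0 < r by apply: lt_le_trans r1.
set E := (\esum_(i in [set: I]) (nc (x i) `^ r)%:E)%E.
have E0 : (0 <= E)%E by apply: esum_ge0 => i _; rewrite lee_fin powR_ge0.
have -> : (lp_norm r%:E x <= M%:E)%E = (E <= (M `^ r)%:E)%E.
  rewrite /lp_norm -/E; apply/idP/idP => h.
    have : (poweR (poweR E r^-1) r <= poweR M%:E r)%E.
      apply: (gt0_ler_poweR (ltW r0) _ _ h).
        by rewrite in_itv /= poweR_ge0 leey.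
      by rewrite in_itv /= lee_fin M0 leey.
    by rewrite -poweRrM mulVf ?gt_eqF// poweRe1// poweR_EFin.
  have ri0 : 0 <= r^-1 by rewrite invr_ge0 ltW.
  have : (poweR E r^-1 <= poweR (M `^ r)%:E r^-1)%E.
    apply: (gt0_ler_poweR ri0 _ _ h); rewrite in_itv /= ?E0 ?leey//.
    by rewrite lee_fin powR_ge0.
  by rewrite poweR_EFin -powRrM mulfV ?gt_eqF// powRr1.
have key s : uniq s -> (\sum_(i \in [set` s]) (nc (x i) `^ r)%:E)%E
    = (\sum_(i <- s) nc (x i) `^ r)%:E.
  by move=> us; rewrite -fsbig_seq//= sumEFin.
split=> [h s us|h].
  rewrite -lee_fin -key//; apply: le_trans h; apply: ereal_sup_ubound.
  by exists [set` s] => //; split.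
apply: ge_ereal_sup => _ [X [fX _] <-].
have [s us ->] : exists2 s : seq I, uniq s & X = [set` s].
  have /finite_seqP[s ->] := fX.
  exists (undup s); first exact: undup_uniq.
  by apply/seteqP; split=> i /=; rewrite mem_undup.
by rewrite key// lee_fin h.
Qed.

Lemma nleP_sup (I : choiceType) (x : cseq R I) (M : R) :
  (lp_norm +oo%E x <= M%:E)%E <-> forall i, nc (x i) <= M.
Proof.
split=> [h i|h].
  by rewrite -lee_fin; apply: le_trans h; apply: ereal_sup_ubound; exists i.
by apply: ge_ereal_sup => _ [i _ <-]; rewrite lee_fin h.
Qed.

Lemma lp_norm_ge0 (I : choiceType) (x : cseq R I) (i0 : I) : (0 <= lp_norm p x)%E.
Proof.
case: p hp => [r|_|]//=; first by move=> _; exact: poweR_ge0.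
apply: (@le_trans _ _ (nc (x i0))%:E); first by rewrite lee_fin nc_ge0.
by apply: ereal_sup_ubound; exists i0.
Qed.

Lemma nle_ge0 (I : choiceType) (x : cseq R I) (i0 : I) (M : R) : nle x M -> 0 <= M.
Proof. by move=> h; rewrite -lee_fin; apply: le_trans h; exact: lp_norm_ge0. Qed.

Lemma nle_weak (I : choiceType) (x : cseq R I) (M : R) K : nle x M -> M <= K -> nle x K.
Proof. by move=> h MK; apply: le_trans h _; rewrite lee_fin. Qed.

Lemma nle_adherent (I : choiceType) (x : cseq R I) (M : R) :
  (forall e, 0 < e -> nle x (M + e)) -> nle x M.
Proof. by move=> h; apply/lee_addgt0Pr => e e0; rewrite -EFinD; exact: h. Qed.

(* Covers monotonicity, translation, restriction and extension by zero. *)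
Lemma nle_dom (I J : choiceType) (g : J -> I) (x : cseq R I) (y : cseq R J) (M : R) :
  0 <= M ->
  (forall j, y j != 0 -> nc (y j) <= nc (x (g j))) ->
  (forall j k, y j != 0 -> y k != 0 -> g j = g k -> j = k) ->
  nle x M -> nle y M.
Proof.
rewrite /nle => M0 hxy hg.
case: p hp => [r|_|]//=; last first.
  move=> /nleP_sup h; apply/nleP_sup => j.
  by have [->|/hxy/le_trans->//] := eqVneq (y j) 0; rewrite nc0.
rewrite lee_fin => r1 /(nleP_fin _ r1 M0) h.
have r0 : 0 < r by apply: lt_le_trans r1.
apply/(nleP_fin _ r1 M0) => s us.
pose t := [seq j <- s | y j != 0].
have ut : uniq (map g t).
  rewrite map_inj_in_uniq ?filter_uniq// => j k.
  by rewrite !mem_filter => /andP[+ _] /andP[+ _]; exact: hg.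
apply: le_trans (h _ ut).
rewrite big_map big_filter (bigID (fun j => y j != 0))/= [X in _ + X]big1 ?addr0.
  apply: ler_sum => j yj; apply: (ge0_ler_powR (ltW r0)); rewrite ?nnegrE ?nc_ge0//.
  exact: hxy.
by move=> j /negPn/eqP ->; rewrite nc0 powR0// gt_eqF.
Qed.

(** Minkowski's inequality, from the convexity of [t ^ r] for finite exponents. *)
Lemma nleD (I : choiceType) (x y : cseq R I) (M K : R) :
  0 <= M -> 0 <= K -> nle x M -> nle y K -> nle (x + y) (M + K).
Proof.
move=> M0 K0 hx hy.
(* The convexity argument divides by the bounds; zero bounds are reached by enlarging both by
   [e / 2]. *)
suff main (M' K' : R) : 0 < M' -> 0 < K' -> nle x M' -> nle y K' ->
    nle (x + y) (M' + K').
  apply: nle_adherent => e e0.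
  have -> : M + K + e = (M + e / 2) + (K + e / 2) by field.
  apply: main; rewrite ?ltr_wpDl ?divr_gt0//; apply: nle_weak; try eassumption;
    by rewrite lerDl divr_ge0// ltW.
move=> {M0 K0 hx hy} {M K} M0 K0; rewrite /nle.
case: p hp => [r|_|]//=; last first.
  move=> /nleP_sup hx /nleP_sup hy; apply/nleP_sup => i.
  by apply: le_trans (ncD _ _) _; exact: lerD.
rewrite lee_fin => r1; have r0 : 0 < r by apply: lt_le_trans r1.
move=> /(nleP_fin _ r1 (ltW M0)) hx /(nleP_fin _ r1 (ltW K0)) hy.
have MK0 : 0 < M' + K' by exact: addr_gt0.
apply/(nleP_fin _ r1 (ltW MK0)) => s us.
(* With this weight, (|x i| + |y i|) / (M' + K') is a convex combination of |x i| / M' and |y i| /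
   K', whose [r]-th powers each sum to at most 1. *)
pose l := M' / (M' + K').
have l01 : 0 <= l <= 1.
  apply/andP; split; first by apply: divr_ge0; exact: ltW.
  by rewrite ler_pdivrMr// mul1r lerDl ltW.
have conv a b : 0 <= a -> 0 <= b ->
    (l * a + (1 - l) * b) `^ r <= l * a `^ r + (1 - l) * b `^ r.
  move=> a0 b0.
  have := @convex_powR R r r1 (Itv01 (andP l01).1 (andP l01).2) a b.
  by rewrite !inE/= !in_itv/= a0 b0 => /(_ isT isT); rewrite !convRE.
have step i : nc ((x + y) i) `^ r <=
    (M' + K') `^ r * (l * (nc (x i) / M') `^ r + (1 - l) * (nc (y i) / K') `^ r).
  have := conv (nc (x i) / M') (nc (y i) / K') (divr_ge0 (nc_ge0 _) (ltW M0))
    (divr_ge0 (nc_ge0 _) (ltW K0)).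
  have -> : l * (nc (x i) / M') + (1 - l) * (nc (y i) / K') =
      (nc (x i) + nc (y i)) / (M' + K').
    by rewrite /l; field; rewrite !gt_eqF.
  move=> /(ler_wpM2l (powR_ge0 (M' + K') r)); apply: le_trans.
  have xy0 : 0 <= nc (x i) + nc (y i) by rewrite addr_ge0 ?nc_ge0.
  rewrite -powRM ?(ltW MK0) ?(divr_ge0 xy0 (ltW MK0))//.
  rewrite mulrCA mulfV ?gt_eqF// mulr1.
  by apply: (ge0_ler_powR (ltW r0)); rewrite ?nnegrE ?nc_ge0//; exact: ncD.
apply: le_trans (ler_sum _ (fun i _ => step i)) _.
rewrite -mulr_sumr -[leRHS]mulr1 ler_wpM2l ?powR_ge0//.
rewrite big_split/= -!mulr_sumr.
have nrm (z : cseq R I) N : 0 < N ->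
    (forall s, uniq s -> \sum_(i <- s) nc (z i) `^ r <= N `^ r) ->
    \sum_(i <- s) (nc (z i) / N) `^ r <= 1.
  move=> N0 hz; have := hz s us.
  have N1 : 0 < N `^ r by rewrite powR_gt0.
  have e i : nc (z i) `^ r = (nc (z i) / N) `^ r * N `^ r.
    by rewrite -powRM ?(ltW N0) ?(divr_ge0 (nc_ge0 _) (ltW N0))// divfK// gt_eqF.
  by rewrite (eq_bigr _ (fun i _ => e i)) -mulr_suml -[leRHS]mul1r ler_pM2r.
have := nrm _ _ M0 hx; have := nrm _ _ K0 hy; case/andP: l01 => l0 l1.
set a := \sum_(i <- s) _; set b := \sum_(i <- s) _ => b1 a1.
have l1' : 0 <= 1 - l by rewrite subr_ge0.
by have := ler_wpM2l l0 a1; have := ler_wpM2l l1' b1; lra.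
Qed.

Lemma nleZ (I : choiceType) (c : Cplx R) (x : cseq R I) (M : R) :
  0 <= M -> nle x M -> nle (c *: x) (nc c * M).
Proof.
move=> M0; rewrite /nle.
case: p hp => [r|_|]//=; last first.
  move=> /nleP_sup hx; apply/nleP_sup => i.
  by rewrite ncM ler_wpM2l ?nc_ge0.
rewrite lee_fin => r1; have r0 : 0 < r by apply: lt_le_trans r1.
move=> /(nleP_fin _ r1 M0) hx.
apply/(nleP_fin _ r1 (mulr_ge0 (nc_ge0 _) M0)) => s us.
rewrite powRM ?nc_ge0//.
apply: le_trans (ler_wpM2l (powR_ge0 _ _) (hx s us)).
by rewrite mulr_sumr ler_sum// => i _; rewrite ncM powRM ?nc_ge0.
Qed.

Lemma nle_point (I : choiceType) (x : cseq R I) i0 :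
  (forall i, i != i0 -> x i = 0) -> nle x (nc (x i0)).
Proof.
move=> h0; rewrite /nle.
case: p hp => [r|_|]//=; last first.
  by apply/nleP_sup => i; have [->//|/h0->] := eqVneq i i0; rewrite nc0 nc_ge0.
rewrite lee_fin => r1; have r0 : 0 < r by apply: lt_le_trans r1.
apply/(nleP_fin _ r1 (nc_ge0 _)) => s us.
have z i : i != i0 -> nc (x i) `^ r = 0 by move/h0 => ->; rewrite nc0 powR0// gt_eqF.
have [is0|ns0] := boolP (i0 \in s).
  by rewrite (bigD1_seq i0)//= big1 ?addr0.
rewrite big_seq big1 ?powR_ge0// => i si; apply: z.
by apply: contraNneq ns0 => <-.
Qed.

Lemma nle_coord (I : choiceType) (x : cseq R I) (M : R) i : nle x M -> nc (x i) <= M.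
Proof.
move=> h; have M0 : 0 <= M := nle_ge0 i h.
move: h; rewrite /nle.
case: p hp => [r|_|]//=; last by move=> /nleP_sup.
rewrite lee_fin => r1; have r0 : 0 < r by apply: lt_le_trans r1.
move=> /(nleP_fin _ r1 M0) /(_ [:: i] isT); rewrite big_seq1.
rewrite leNgt => hh; rewrite leNgt; apply: contra hh => hh.
by apply: gt0_ltr_powR; rewrite // nnegrE ?nc_ge0.
Qed.

Definition restr (I : choiceType) (P : pred I) (x : cseq R I) : cseq R I :=
  fun i => if P i then x i else 0.

Lemma nle_restr (I : choiceType) (P : pred I) (x : cseq R I) (M : R) :
  0 <= M -> nle x M -> nle (restr P x) M.
Proof.
move=> M0; apply: (nle_dom (g := id)) => // i; rewrite /restr.
by case: ifP => //; rewrite eqxx.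
Qed.

Lemma nle_finite (I : choiceType) (x : cseq R I) (M : R) : 0 <= M ->
  (forall s : seq I, nle (restr (mem s) x) M) -> nle x M.
Proof.
move=> M0; unfold nle.
case: p hp => [r|_|]//=; last first.
  move=> h; apply/nleP_sup => i.
  by have /nleP_sup/(_ i) := h [:: i]; rewrite /restr /= inE eqxx.
rewrite lee_fin => r1; have r0 : 0 < r by apply: lt_le_trans r1.
move=> h; apply/(nleP_fin _ r1 M0) => s us.
have /(nleP_fin _ r1 M0)/(_ _ us) := h s.
rewrite big_seq [X in _ -> X <= _]big_seq; congr (_ <= _).
by apply: eq_bigr => i si; rewrite /restr/= si.
Qed.

Lemma nle0 (I : choiceType) (M : R) : 0 <= M -> nle (0 : cseq R I) M.
Proof.
move=> M0; rewrite /nle.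
case: p hp => [r|_|]//; last by apply/nleP_sup => i; rewrite nc0.
rewrite lee_fin => r1; apply/(nleP_fin _ r1 M0) => s _.
rewrite big1 ?powR_ge0// => i _; rewrite nc0 powR0// gt_eqF//.
exact: lt_le_trans r1.
Qed.

Lemma nle_sum (I : choiceType) (J : Type) (s : seq J) (P : pred J)
    (x : J -> cseq R I) (M : J -> R) :
  (forall j, P j -> 0 <= M j) -> (forall j, P j -> nle (x j) (M j)) ->
  nle (\sum_(j <- s | P j) x j) (\sum_(j <- s | P j) M j).
Proof.
move=> M0 h; elim: s => [|j s IH]; first by rewrite !big_nil; exact: nle0.
rewrite !big_cons; case: ifP => // Pj.
by apply: nleD; rewrite ?sumr_ge0 ?M0// ?h.
Qed.

Lemma nle_seq (I : choiceType) (s : seq I) (x : cseq R I) (c : R) :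
  0 <= c -> (forall i, i \in s -> nc (x i) <= c) ->
  nle (restr (mem s) x) ((size s)%:R * c).
Proof.
move=> c0; elim: s => [|i s IH] h.
  by rewrite mul0r; apply: (nle_dom (g := id)) (nle0 _ (lexx 0)) => // j; rewrite /restr/= eqxx.
have -> : restr (mem (i :: s)) x =
    restr (pred1 i) (restr (mem (i :: s)) x) +
    restr (predC1 i) (restr (mem s) x).
  apply/funext => j; rewrite /restr /= !fctE inE /=.
  by case: eqP => [->|]/=; rewrite ?addr0 ?add0r.
rewrite /= -add1n natrD mulrDl mul1r; apply: nleD => //.
- by rewrite mulr_ge0.
- apply: (@nle_weak _ _ (nc (restr (pred1 i) (restr (mem (i :: s)) x) i))).
    by apply: nle_point => j /negPf ji; rewrite /restr /= ji.
  by rewrite /restr/= eqxx inE eqxx/= h// inE eqxx.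
- apply: nle_restr; rewrite ?mulr_ge0//; apply: IH => j js.
  by rewrite h// inE js orbT.
Qed.

(** Balls of l^p are closed under coordinatewise convergence (Fatou). On a finite set [s], replacing
    [x] by an approximation within [e / (size s).+1] costs at most [e]. *)
Lemma nle_lim (I : choiceType) (x : cseq R I) (M : R) : 0 <= M ->
  (forall (s : seq I) e, 0 < e ->
     exists2 y, nle y M & forall i, i \in s -> nc (x i - y i) <= e) ->
  nle x M.
Proof.
move=> M0 h; apply: nle_finite => // s; apply: nle_adherent => e e0.
have n0 : 0 < (size s).+1%:R :> R by rewrite ltr0n.
have [y yM hy] := h s _ (divr_gt0 e0 n0).
have -> : restr (mem s) x = restr (mem s) y + restr (mem s) (x - y).
  apply/funext => i; rewrite !fctE /restr; case: ifP; rewrite ?addr0//.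
  by move=> _; rewrite addrCA subrr addr0.
apply: nleD => //; [exact: ltW|exact: nle_restr|].
apply: nle_weak (nle_seq _ hy) _; first by rewrite divr_ge0// ltW.
by rewrite mulrCA ler_piMr ?(ltW e0)// ler_pdivrMr// mul1r ler_nat.
Qed.

Lemma lpP (I : choiceType) (i0 : I) (x : cseq R I) :
  lp p x <-> exists2 M, 0 <= M & nle x M.
Proof.
split=> [h|[M _ h]]; last by apply: le_lt_trans h _; rewrite ltey.
have h0 := lp_norm_ge0 x i0.
exists (fine (lp_norm p x)); first exact: fine_ge0.
by rewrite /nle fineK// ge0_fin_numE.
Qed.

Lemma lp_nle (I : choiceType) (x : cseq R I) (M : R) : nle x M -> lp p x.
Proof. by move=> h; apply: le_lt_trans h _; rewrite ltey. Qed.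

Lemma lpD (I : choiceType) (i0 : I) (x y : cseq R I) : lp p x -> lp p y -> lp p (x + y).
Proof.
move=> /(lpP i0)[M M0 hx] /(lpP i0)[K K0 hy]; apply/(lpP i0).
by exists (M + K); [exact: addr_ge0|exact: nleD].
Qed.

Lemma lpZ (I : choiceType) (i0 : I) c (x : cseq R I) : lp p x -> lp p (c *: x).
Proof.
move=> /(lpP i0)[M M0 hx]; apply/(lpP i0).
by exists (nc c * M); [rewrite mulr_ge0// nc_ge0|exact: nleZ].
Qed.

Lemma lp0 (I : choiceType) : lp p (0 : cseq R I).
Proof. exact: lp_nle (nle0 _ (lexx 0)). Qed.

Lemma lp_sum (I : choiceType) (i0 : I) (J : Type) (s : seq J) (P : pred J)
    (x : J -> cseq R I) :
  (forall j, P j -> lp p (x j)) -> lp p (\sum_(j <- s | P j) x j).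
Proof.
by move=> h; apply: big_ind => //; [exact: lp0|move=> y z; exact: lpD].
Qed.

End Norm.

(** * Coordinatewise compactness *)

Section Compactness.
Variable R : realType.

(** Tychonoff's theorem for a product of segments. A cluster point, seen on finitely many
    coordinates at arbitrarily late indices, takes the place of a diagonal subsequence. *)
Lemma cluster_real (J : eqType) (x : nat -> J -> R) (b : J -> R) :
  (forall n j, `|x n j| <= b j) ->
  exists y : J -> R, forall (s : seq J) (e : R) (n0 : nat), 0 < e ->
    exists2 n, (n0 <= n)%N & forall j, j \in s -> `|x n j - y j| <= e.
Proof.
move=> hb.
have := @tychonoff J (fun=> R) (fun j => `[- b j, b j]%classic)
  (fun j => @segment_compact R (- b j) (b j)).
set K := [set f : forall j : J, R | _].
pose u : nat -> (prod_topology (fun _ : J => R)) := fun n => x n.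
have FK : (u @ \oo) K.
  by exists 0%N => // n _ j /=; rewrite in_itv/= -ler_norml.
move=> /(_ (u @ \oo) _ FK)[y [_ cl]].
exists y => s e n0 e0.
have nb : nbhs (y : prod_topology (fun _ : J => R))
    [set f : prod_topology (fun _ : J => R) | forall j, j \in s -> `|f j - y j| <= e].
  elim: s => [|j s IH]; first by apply: filterS filterT.
  have hj : nbhs (y : prod_topology (fun _ : J => R))
      [set f : prod_topology (fun _ : J => R) | `|f j - y j| <= e].
    have /(_ [set t : R | `|t - y j| <= e]) := @proj_continuous J (fun=> R) j y.
    apply; apply/nbhs_ballP; exists e => //= t; rewrite /ball/= distrC.
    exact: ltW.
  apply: filterS (filterI IH hj) => f [h1 h2] k.
  by rewrite inE => /predU1P[->|/h1].
have nt : (u @ \oo) [set f | exists2 n, (n0 <= n)%N & f = u n].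
  by exists n0 => // n /= hn; exists n.
by have [f [[n hn ->] h]] := cl _ _ nt nb; exists n.
Qed.

Lemma cluster_cplx (J : eqType) (x : nat -> J -> Cplx R) (b : J -> R) :
  (forall n j, nc (x n j) <= b j) ->
  exists y : J -> Cplx R, forall (s : seq J) (e : R) (n0 : nat), 0 < e ->
    exists2 n, (n0 <= n)%N & forall j, j \in s -> nc (x n j - y j) <= e.
Proof.
move=> hb.
(* Each complex coordinate becomes two real ones, indexed by a boolean. *)
pose part (z : Cplx R) (c : bool) : R := if c then complex.Re z else complex.Im z.
have part_le z c : `|part z c| <= nc z.
  case: z => u v; rewrite /nc/=; case: c => /=; rewrite -sqrtr_sqr ler_wsqrtr//.
    by rewrite lerDl sqr_ge0.
  by rewrite lerDr sqr_ge0.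
have le_part z : nc z <= `|part z true| + `|part z false|.
  case: z => u v; rewrite /nc/= -(ger0_norm (addr_ge0 (normr_ge0 u) (normr_ge0 v))).
  rewrite -sqrtr_sqr ler_wsqrtr// sqrrD !real_normK ?num_real//.
  by rewrite addrAC lerDl mulrn_wge0// mulr_ge0.
have [] := @cluster_real (J * bool)%type (fun n j => part (x n j.1) j.2) (fun j => b j.1).
  by move=> n [j c] /=; apply: le_trans (hb n j).
move=> y hy; exists (fun j => Complex (y (j, true)) (y (j, false))) => s e n0 e0.
have e20 : 0 < e / 2 by rewrite divr_gt0.
have [n nn0 h] := hy [seq (j, c) | j <- s, c <- [:: true; false]] _ n0 e20.
exists n => // j js; apply: le_trans (le_part _) _.
have mem c : (j, c) \in [seq (j, c) | j <- s, c <- [:: true; false]].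
  by apply/allpairsP; exists (j, c); rewrite !inE; case: c.
have pB c : part (x n j - Complex (y (j, true)) (y (j, false))) c
    = part (x n j) c - y (j, c).
  by case: (x n j) => ? ?; case: c.
have l c : `|part (x n j - Complex (y (j, true)) (y (j, false))) c| <= e / 2.
  by rewrite pB; exact: h _ (mem c).
by rewrite [leRHS](splitr e); apply: lerD.
Qed.

End Compactness.

(** * Dimensions and tridiagonal operators *)

Section Dim.
Variables (R : realType) (V : lmodType (Cplx R)).
Implicit Types X Y : set V.

Lemma dim_quot_bounded X Y : (dim_quot R X Y < +oo)%E ->
  exists N : nat, forall n (b : 'I_n -> V), (forall k, X (b k)) -> indep_mod Y b ->
    (n <= N)%N.
Proof.
move=> h; have [m hm] : exists m : R, (dim_quot R X Y <= m%:E)%E.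
  case: (dim_quot R X Y) h => [r||]// _; first by exists r.
  by exists 0; rewrite leNye.
exists (Num.trunc `|m|) => n b Xb ib.
rewrite -ltnS -(ltr_nat R); apply: le_lt_trans (truncnS_gt _).
apply: le_trans (ler_norm m); rewrite -lee_fin; apply: le_trans hm.
by apply: ereal_sup_ubound; exists n => //; exists b.
Qed.

Lemma dim_quot_finite X Y (N : nat) :
  (forall n (b : 'I_n -> V), (forall k, X (b k)) -> indep_mod Y b -> (n <= N)%N) ->
  (dim_quot R X Y < +oo)%E.
Proof.
move=> h; apply: (@le_lt_trans _ _ (N%:R)%:E); last exact: ltey.
apply: ge_ereal_sup => _ [n [b Xb ib] <-].
by rewrite lee_fin ler_nat; exact: h Xb ib.
Qed.

Lemma dim_quot_neq0 X Y : dim_quot R X Y <> 0%E -> exists2 x, X x & ~ Y x.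
Proof.
move=> h; apply: contrapT => h'; apply: h; apply/eqP; rewrite eq_le; apply/andP; split.
  apply: ge_ereal_sup => _ [[|n] [b Xb ib] <-]; first exact: lexx.
  exfalso; apply: h'; exists (b ord0) => // Yb.
  have := ib (fun k => (k == ord0)%:R); rewrite (bigD1 ord0)//= scale1r big1 ?addr0.
    by move=> /(_ Yb ord0)/eqP; rewrite oner_eq0.
  by move=> k /negPf ->; rewrite scale0r.
apply: ereal_sup_ubound; exists 0%N => //.
by exists (fun k => 0) => [[]//|c _ []].
Qed.

Section Subspace.
Variables X Y : set V.
Hypothesis YZ : forall c v, Y v -> Y (c *: v).

(** Dividing a relation by its coefficient of largest modulus makes that coefficient 1 and bounds
    the others by 1. This normalisation is what turns dependence into norm estimates. *)
Lemma dim_quot_dep : (dim_quot R X Y < +oo)%E ->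
  exists N : nat, forall b : 'I_N.+1 -> V, (forall k, X (b k)) ->
    exists d : 'I_N.+1 -> Cplx R, [/\ Y (\sum_k d k *: b k),
      exists s, d s = 1 & forall k, nc (d k) <= 1].
Proof.
move=> /dim_quot_bounded[N hN]; exists N => b Xb.
have /existsNP[c /not_implyP[Yc /existsNP[k0 ck0]]] : ~ indep_mod Y b.
  by move/(hN _ _ Xb); rewrite ltnn.
have [s _ smax] := arg_maxP (fun k => nc (c k)) (erefl : xpredT k0).
have ncs : 0 < nc (c s).
  apply: lt_le_trans (smax k0 isT); rewrite lt_neqAle nc_ge0 andbT eq_sym nc_eq0.
  exact/eqP.
have cs0 : c s != 0 by rewrite -nc_eq0 gt_eqF.
exists (fun k => (c s)^-1 * c k); split.
- have := YZ (c s)^-1 Yc; congr Y; rewrite scaler_sumr.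
  by apply: eq_bigr => k _; rewrite scalerA.
- by exists s; rewrite mulVf.
- move=> k; rewrite ncM ncV mulrC ler_pdivrMr// mul1r; exact: smax k isT.
Qed.

(** An independent family of maximal length spans: adjoining [y] creates a relation, in which the
    coefficient of [y] cannot vanish. *)
Lemma dim_quot_basis : (dim_quot R X Y < +oo)%E ->
  exists (n : nat) (b : 'I_n -> V), [/\ forall k, X (b k), indep_mod Y b &
    forall y, X y -> exists c : 'I_n -> Cplx R, Y (y - \sum_k c k *: b k)].
Proof.
move=> /dim_quot_bounded[N hN].
pose P n := `[< exists2 b : 'I_n -> V, forall k, X (b k) & indep_mod Y b >].
have P0 : exists n, P n.
  by exists 0%N; apply/asboolP; exists (fun=> 0) => [[]//|c _ []].
have PN n : P n -> (n <= N)%N by move=> /asboolP[b Xb /(hN _ _ Xb)].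
have [n /asboolP[b Xb ib] nmax] := ex_maxnP P0 PN.
exists n, b; split => // y Xy.
pose b' (k : 'I_n.+1) := if unlift ord_max k is Some j then b j else y.
have b'm : b' ord_max = y by rewrite /b' unlift_none.
have b'l j : b' (lift ord_max j) = b j by rewrite /b' liftK.
have sumE (c : 'I_n.+1 -> Cplx R) : \sum_k c k *: b' k =
    c ord_max *: y + \sum_k c (lift ord_max k) *: b k.
  rewrite (bigD1_ord ord_max)//= b'm; congr (_ + _).
  by apply: eq_bigr => k _; rewrite b'l.
have /existsNP[c /not_implyP[Yc /existsNP[k0 ck0]]] : ~ indep_mod Y b'.
  move=> ib'; suff /nmax : P n.+1 by rewrite ltnn.
  apply/asboolP; exists b' => // k; rewrite /b'.
  by case: unliftP => [j|] _.
move: Yc; rewrite sumE => Yc.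
have cm : c ord_max != 0.
  apply/eqP => cm; apply: ck0; case: (unliftP ord_max k0) => [j|] ->//.
  by move: Yc; rewrite cm scale0r add0r => /ib/(_ j).
exists (fun k => - ((c ord_max)^-1 * c (lift ord_max k))).
have := YZ (c ord_max)^-1 Yc; congr Y.
rewrite scalerDr scalerA mulVf// scale1r scaler_sumr -sumrN; congr (_ + _).
by apply: eq_bigr => k _; rewrite scalerA scaleNr opprK.
Qed.

(** Eliminating [e] between two vectors yields a relation with coefficients [t1] and [- t0]; if both
    vanish, the first vector already lies in [Y]. *)
Lemma dim_quot_le1 (e : V) :
  (forall u v, Y u -> Y v -> Y (u + v)) ->
  (forall x, X x -> exists t : Cplx R, Y (x - t *: e)) ->
  (dim_quot R X Y < +oo)%E.
Proof.
move=> YD he; apply: (@dim_quot_finite _ _ 1%N) => -[|[|n]]// b Xb ib; exfalso.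
pose k0 : 'I_n.+2 := ord0; pose k1 : 'I_n.+2 := lift ord0 ord0.
have two (c0 c1 : Cplx R) : Y (c0 *: b k0 + c1 *: b k1) -> c0 = 0 /\ c1 = 0.
  pose c (k : 'I_n.+2) := if k == k0 then c0 else if k == k1 then c1 else 0.
  have := ib c; rewrite (bigD1 k0)//= (bigD1 k1)//= big1 => [|k /andP[]]; last first.
    by rewrite /c => /negPf -> /negPf ->; rewrite scale0r.
  by rewrite addr0 => h /h hc; have := hc k0; have := hc k1.
have [t0 Y0] := he _ (Xb k0); have [t1 Y1] := he _ (Xb k1).
have [] := two t1 (- t0).
  have := YD _ _ (YZ t1 Y0) (YZ (- t0) Y1); congr Y.
  rewrite !scalerBr !scalerA addrACA -opprD -scalerDl.
  by rewrite mulNr [t1 * _]mulrC subrr scale0r subr0.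
move=> _ /eqP; rewrite oppr_eq0 => /eqP t00.
have [] := two 1 0; last by move=> /eqP; rewrite oner_eq0.
by move: Y0; rewrite t00 !scale0r scale1r subr0 addr0.
Qed.

End Subspace.

End Dim.

Section Transfer.
Variables (R : realType) (V V' : lmodType (Cplx R)).

(** Families independent modulo [Y] go to families independent modulo [Y'], because a relation among
    the images pulls back. *)
Lemma dim_quot_transfer (X Y : set V) (X' Y' : set V') (f : V -> V') :
  (forall n (c : 'I_n -> Cplx R) b, f (\sum_k c k *: b k) = \sum_k c k *: f (b k)) ->
  (forall x, X x -> X' (f x)) ->
  (forall n (c : 'I_n -> Cplx R) b, (forall k, X (b k)) ->
     Y' (f (\sum_k c k *: b k)) -> Y (\sum_k c k *: b k)) ->
  (dim_quot R X' Y' < +oo)%E -> (dim_quot R X Y < +oo)%E.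
Proof.
move=> fl fX fY /dim_quot_bounded[N hN]; apply: (@dim_quot_finite _ _ _ _ N).
move=> n b Xb ib; apply: (hN n (f \o b)) => [k|c]; first exact: fX.
by rewrite -fl => /(fY _ _ _ Xb); exact: ib.
Qed.

End Transfer.

(** * Tridiagonal operators on two-sided sequences *)

Section Tridiag.
Variables (R : realType).
Implicit Types (a : int -> int -> Cplx R) (x y : cseq R int).

(** The three-term form of [mxop]: it reads only the three central diagonals, so that linearity and
    translation become ring identities. *)
Definition tri a x : cseq R int := fun i =>
  a i (i - 1) * (x (i - 1) : Cplx R) + a i i * (x i : Cplx R)
    + a i (i + 1) * (x (i + 1) : Cplx R).

Lemma triD a x y : tri a (x + y) = tri a x + tri a y.
Proof. by apply/funext => i; rewrite /tri !fctE; ring. Qed.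

Lemma triZ a (c : Cplx R) x : tri a (c *: x) = c *: tri a x.
Proof.
apply/funext => i; rewrite /tri; change (
  a i (i - 1) * (c * (x (i - 1) : Cplx R)) + a i i * (c * (x i : Cplx R))
    + a i (i + 1) * (c * (x (i + 1) : Cplx R)) = 
  c * (a i (i - 1) * (x (i - 1) : Cplx R) + a i i * (x i : Cplx R)
    + a i (i + 1) * (x (i + 1) : Cplx R))).
by ring.
Qed.

Lemma tri0 a : tri a 0 = 0.
Proof. by have := triZ a 0 0; rewrite !scale0r. Qed.

Lemma triN a x : tri a (- x) = - tri a x.
Proof. by rewrite -scaleN1r triZ scaleN1r. Qed.

Lemma triB a x y : tri a (x - y) = tri a x - tri a y.
Proof. by rewrite triD triN. Qed.

Lemma tri_sum a n (c : 'I_n -> Cplx R) (x : 'I_n -> cseq R int) :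
  tri a (\sum_k c k *: x k) = \sum_k c k *: tri a (x k).
Proof.
apply: (big_ind2 (fun u v => tri a u = v)); first exact: tri0.
  by move=> u u' v v' <- <-; rewrite triD.
by move=> k _; rewrite triZ.
Qed.

Lemma mxop_tri a : (forall i j : int, 1 < `|i - j| -> a i j = 0) ->
  mxop a = tri a.
Proof.
move=> a0; apply/funext => x; apply/funext => i; rewrite /mxop.
rewrite (fsbigE [:: i - 1; i; i + 1]) //=.
- by rewrite !big_cons big_nil !in_setT /tri addr0 !addrA.
- by rewrite !inE; apply/and3P; split=> //; lia.
- by move=> j _; rewrite !inE => h; rewrite a0 ?mul0r//; lia.
Qed.

Variable p : \bar R.
Hypothesis hp : (1 <= p)%E.

Lemma nle_mul (f : int -> Cplx R) (g : int -> int) x (m M : R) : injective g ->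
  (forall i, nc (f i) <= m) -> 0 <= M -> nle p x M ->
  nle p (fun i => f i * (x (g i) : Cplx R) : (Cplx R)^o) (m * M).
Proof.
move=> gi fm M0 xM; have m0 : 0 <= m := le_trans (nc_ge0 _) (fm 0).
have := nleZ hp (m%:C)%C M0 xM; rewrite nc_real ger0_norm// => h.
apply: (nle_dom hp (g := g)) h => //; first by rewrite mulr_ge0.
  move=> j _.
  change (nc (f j * (x (g j) : Cplx R)) <= nc ((m%:C)%C * (x (g j) : Cplx R))).
  rewrite !ncM nc_real.
  by rewrite ger0_norm// ler_wpM2r// nc_ge0.
by move=> j k _ _ /gi.
Qed.

Definition bdd a (m : R) := forall i j, `|i - j| <= 1 -> nc (a i j) <= m.

Lemma nle_tri a x (m M : R) : bdd a m -> 0 <= M ->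
  nle p x M -> nle p (tri a x) (3 * m * M).
Proof.
move=> am M0 xM; have m0 : 0 <= m := le_trans (nc_ge0 _) (am 0 0 isT).
have mM0 : 0 <= m * M by exact: mulr_ge0.
have -> : 3 * m * M = m * M + m * M + m * M by ring.
apply: (@nleD _ _ hp _ ((fun i => a i (i - 1) * (x (i - 1) : Cplx R) : (Cplx R)^o)
    + (fun i => a i i * (x i : Cplx R) : (Cplx R)^o))
    (fun i => a i (i + 1) * (x (i + 1) : Cplx R) : (Cplx R)^o));
  rewrite ?addr_ge0//; last first.
  by apply: (@nle_mul (fun i => a i (i + 1)) (fun i => i + 1)) => //
    [i j /addIr//|i]; apply: am; lia.
apply: nleD => //.
  by apply: (@nle_mul (fun i => a i (i - 1)) (fun i => i - 1)) => //
    [i j /addIr//|i]; apply: am; lia.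
by apply: (@nle_mul (fun i => a i i) id) => // i; apply: am; lia.
Qed.

Definition shift (k : int) x : cseq R int := fun i => x (i - k).

Lemma nle_shift k x (M : R) : 0 <= M -> nle p x M -> nle p (shift k x) M.
Proof. by move=> M0; apply: (nle_dom hp (g := fun i => i - k)) => // i j _ _ /addIr. Qed.

End Tridiag.

(** * Open mapping *)

Section OpenMapping.
Variables (R : realType) (p : \bar R).
Hypothesis hp : (1 <= p)%E.

Lemma nc_arb (z : Cplx R) (B : R) :
  (forall e, 0 < e -> nc z <= B * e) -> z = 0.
Proof.
move=> h; apply/eqP; rewrite -nc_eq0 eq_le nc_ge0 andbT.
have B0 : 0 <= B by have := le_trans (nc_ge0 z) (h 1 ltr01); rewrite mulr1.
have B1 : 0 < B + 1 by rewrite ltr_wpDl.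
apply/ler_addgt0Pl => e e0; rewrite addr0.
apply: le_trans (h _ (divr_gt0 e0 B1)) _.
by rewrite mulrCA ler_piMr ?(ltW e0)// ler_pdivrMr// mul1r lerDl.
Qed.

Lemma nc_tri (a : int -> int -> Cplx R) (x : cseq R int) (m e : R) i :
  (forall j, j \in [:: i - 1; i; i + 1] -> nc (a i j) <= m) ->
  (forall j, j \in [:: i - 1; i; i + 1] -> nc (x j) <= e) ->
  nc (tri a x i) <= 3 * m * e.
Proof.
move=> am xe; rewrite /tri; apply: le_trans (ncD _ _) _.
have t j : j \in [:: i - 1; i; i + 1] -> nc (a i j * (x j : Cplx R)) <= m * e.
  by move=> h; rewrite ncM ler_pM ?nc_ge0 ?am ?xe.
have -> : 3 * m * e = m * e + m * e + m * e by ring.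
apply: lerD; last by apply: t; rewrite !inE eqxx !orbT.
by apply: le_trans (ncD _ _) _; apply: lerD; apply: t; rewrite !inE eqxx ?orbT.
Qed.

Lemma invS_le (e : R) : 0 < e -> exists n0 : nat, forall n, (n0 <= n)%N ->
  (n.+1%:R)^-1 <= e.
Proof.
move=> e0; exists (Num.trunc e^-1) => n h.
rewrite invf_ple ?posrE ?ltr0n//; apply: ltW; apply: lt_le_trans (truncnS_gt _) _.
by rewrite ler_nat.
Qed.

Lemma sum_fctE (I : finType) (F : I -> cseq R int) i :
  (\sum_k F k) i = \sum_k (F k i : Cplx R).
Proof. by elim/big_ind2: _ => // x y u v <- <-. Qed.

Variables (a : int -> int -> Cplx R) (m : R).
Hypothesis am : bdd a m.

Let im : set (cseq R int) := tri a @` lp p.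

Lemma tri_imageZ c v : im v -> im (c *: v).
Proof.
by move=> [x lx <-]; exists (c *: x); [exact: (lpZ hp 0)|exact: triZ].
Qed.

Lemma tri_imageD u v : im u -> im v -> im (u + v).
Proof.
by move=> [x lx <-] [y ly <-]; exists (x + y); [exact: (lpD hp 0)|exact: triD].
Qed.

Section Baire.
Variables (N : nat) (b : 'I_N -> cseq R int).

(** The image of a ball of radius [k] under the map from l^p x C^N that becomes onto l^p once the
    [b j] span a complement of the image of [tri a]. *)
Let K (k : nat) (y : cseq R int) := exists (x : cseq R int) (c : 'I_N -> Cplx R),
  [/\ nle p x k%:R, forall j, nc (c j) <= k%:R & y = tri a x + \sum_j c j *: b j].

(** Approximate preimages lie in a fixed ball, hence cluster coordinatewise. A coordinate of the
    image involves only three coordinates of [x] and the [N] coefficients, so the cluster point is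
    an exact preimage. *)
Lemma closed_image_ball k y :
  (forall e : R, 0 < e -> exists2 z, K k z & nle p (y - z) e) -> K k y.
Proof.
move=> h.
have /choice[f hf] : forall n, exists xc : cseq R int * ('I_N -> Cplx R),
    [/\ nle p xc.1 k%:R, forall j, nc (xc.2 j) <= k%:R &
     nle p (y - (tri a xc.1 + \sum_j xc.2 j *: b j)) (n.+1%:R)^-1].
  move=> n; have [|z [x [c [xk ck ->]]] hz] := h (n.+1%:R)^-1.
    by rewrite invr_gt0 ltr0n.
  by exists (x, c).
pose u n (t : int + 'I_N) : Cplx R :=
  match t with inl i => (f n).1 i | inr j => (f n).2 j end.
have ub n t : nc (u n t) <= k%:R.
  case: t => [i|j] /=; have [h1 h2 _] := hf n; last exact: h2.
  exact: nle_coord h1.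
have [z hz] := @cluster_cplx _ _ u (fun=> k%:R) ub.
pose x : cseq R int := fun i => z (inl i).
pose c : 'I_N -> Cplx R := fun j => z (inr j).
exists x, c; split.
- apply: (nle_lim hp) => // s e e0.
  have [n _ hn] := hz (map inl s) e 0%N e0.
  exists (f n).1 => [|i si]; first by have [] := hf n.
  by rewrite -ncN opprB; apply: hn; apply: map_f.
- move=> j; apply/ler_addgt0Pl => e e0; rewrite /c.
  have [n _ hn] := hz [:: inr j] e 0%N e0.
  have := hn (inr j); rewrite inE eqxx => /(_ isT) h1.
  have -> : z (inr j) = - (u n (inr j) - z (inr j)) + u n (inr j) by ring.
  by apply: le_trans (ncD _ _) _; rewrite ncN lerD// ub.
apply/funext => i; apply/eqP; rewrite -subr_eq0; apply/eqP.
(* The three terms absorb the errors of the approximation of [y], of the three entries of [x], and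
   of the coefficients. *)
pose B := 1 + 3 * m + \sum_j nc (b j i).
apply: (@nc_arb _ B) => e e0; have [n0 hn0] := invS_le e0.
have [n /hn0 ne hn] := hz ([seq inl j | j <- [:: i - 1; i; i + 1]] ++
  [seq inr j | j <- enum 'I_N]) e n0 e0.
have [_ _ /(nle_coord hp i) h1] := hf n.
have -> : y i - (tri a x + \sum_j c j *: b j) i =
   (y - (tri a (f n).1 + \sum_j (f n).2 j *: b j)) i
   + (tri a ((f n).1 - x) i + \sum_j ((f n).2 j - c j) * (b j i : Cplx R)).
  rewrite triB !fctE !sum_fctE -[X in _ = _ + (_ + X)]/(\sum_j _).
  under [X in _ = _ + (_ + X)]eq_bigr do rewrite mulrBl.
  rewrite big_split/= sumrN.
  rewrite -[\sum_(k < N) (c k *: b k) i]/(\sum_(k < N) c k * (b k i : Cplx R)).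
  rewrite -[\sum_(k < N) ((f n).2 k *: b k) i]/(\sum_(k < N) (f n).2 k * (b k i : Cplx R)).
  by ring.
have -> : B * e = e + (3 * m * e + (\sum_j nc (b j i)) * e) by rewrite /B; ring.
apply: le_trans (ncD _ _) _; apply: lerD.
  exact: le_trans h1 ne.
apply: le_trans (ncD _ _) _; apply: lerD.
  apply: nc_tri => // j ij; first by apply: am; move: ij; rewrite !inE; lia.
  apply: (hn (inl j)).
  by rewrite mem_cat map_f.
apply: le_trans (nc_sum _ _ _) _; rewrite mulr_suml; apply: ler_sum => j _.
rewrite ncM mulrC ler_wpM2l ?nc_ge0//; apply: (hn (inr j)).
by rewrite mem_cat orbC map_f// mem_enum.
Qed.

Lemma image_ballB k1 k2 y z : K k1 y -> K k2 z -> K (k1 + k2) (y - z).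
Proof.
move=> [x [c [xk ck ->]]] [x' [c' [xk' ck' ->]]].
exists (x - x'), (fun j => c j - c' j); split.
- rewrite natrD; apply: nleD => //.
  by have := nleZ hp (-1) (ler0n _ _) xk'; rewrite ncN nc1 mul1r scaleN1r.
- move=> j; rewrite natrD; apply: le_trans (ncD _ _) _.
  by rewrite ncN lerD.
rewrite triB opprD addrACA; congr (_ + _); rewrite -sumrB.
by apply: eq_bigr => j _; rewrite scalerBl.
Qed.

(** Baire's argument by hand: if no [K k] contained a ball around 0, nested balls avoiding [K 0],
    [K 1], ... would have a common point, outside every [K k]. *)
Lemma some_image_ball : (forall y, lp p y -> exists k, K k y) ->
  exists (k : nat) (r : R), 0 < r /\ forall z, nle p z r -> K k z.
Proof.
move=> cover; apply: contrapT => no.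
have thin (k : nat) (r : R) : 0 < r -> exists2 z, nle p z r & ~ K k z.
  move=> r0; apply: contrapT => h; apply: no; exists k, r; split => // z zr.
  by apply: contrapT => nK; apply: h; exists z.
have step (k : nat) (yr : cseq R int * R) : exists yr' : cseq R int * R, 0 < yr.2 ->
    [/\ 0 < yr'.2, yr'.2 <= yr.2 / 2, nle p (yr'.1 - yr.1) (yr.2 / 2) &
      forall z, nle p (z - yr'.1) yr'.2 -> ~ K k z].
  case: yr => y r /=; have [r0|r0] := ltP 0 r; last by exists (y, r); rewrite ltNge r0.
  have r20 : 0 < r / 2 by rewrite divr_gt0.
  (* The index is doubled because [y] and [y + z] both in [K k] would put their difference [z] in
     [K (k + k)]. *)
  have [z zr nKz] := thin (k + k)%N _ r20.
  have [y' y'r nKy'] : exists2 y', nle p (y' - y) (r / 2) & ~ K k y'.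
    have [Ky|nKy] := pselect (K k y); last first.
      by exists y => //; rewrite subrr; exact: nle0 (ltW r20).
    exists (y + z); first by rewrite addrC addKr.
    by move=> /image_ballB /(_ Ky); rewrite addrC addKr.
  have [e [e0 he]] : exists e : R, 0 < e /\ forall z, K k z -> ~ nle p (y' - z) e.
    apply: contrapT => h; apply: nKy'; apply: closed_image_ball => e e0.
    apply: contrapT => h'; apply: h; exists e; split=> // w Kw hw; apply: h'.
    by exists w.
  exists (y', Num.min e (r / 2)) => _ /=; split => //.
  - by rewrite lt_min e0.
  - by rewrite ge_min lexx orbT.
  move=> w hw /he; apply; apply: (@nle_weak _ _ _ _ (Num.min e (r / 2))).
    have := nleZ hp (-1) _ hw; rewrite scaleN1r opprB ncN nc1 mul1r; apply.
    by rewrite le_min !ltW.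
  by rewrite ge_min lexx.
have /choice[F hF] : forall kyr : nat * (cseq R int * R), exists yr' : cseq R int * R,
    0 < kyr.2.2 -> [/\ 0 < yr'.2, yr'.2 <= kyr.2.2 / 2,
      nle p (yr'.1 - kyr.2.1) (kyr.2.2 / 2) &
      forall z, nle p (z - yr'.1) yr'.2 -> ~ K kyr.1 z].
  by move=> [k yr]; exact: step.
pose u := fix u n : cseq R int * R := if n is n'.+1 then F (n', u n') else (0, 1).
have u0 n : 0 < (u n).2.
  by elim: n => [|n IH] /=; [exact: ltr01|have [] := hF (n, u n) IH].
have us n := hF (n, u n) (u0 n).
(* Each centre moves by at most half the radius, hence by at most the loss of radius, and these
   losses telescope. *)
have near k n : (k <= n)%N -> nle p ((u n).1 - (u k).1) ((u k).2 - (u n).2).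
  move=> /subnK <-; elim: (n - k)%N => [|d IH].
    by rewrite !subrr; exact: nle0.
  have [_ h1 h2 _] := us (d + k)%N.
  have := nleD hp _ _ h2 IH; rewrite subrKA /= => h.
  apply: nle_weak (h _ _) _; first by rewrite divr_ge0// ltW.
    exact: (nle_ge0 hp 0 IH).
  by move: h1 => /=; set r := (F _).2; lra.
pose bd (i : int) : R := 1.
have ub n i : nc ((u n).1 i) <= bd i.
  have := nle_coord hp i (near 0%N n (leq0n n)) => /=; rewrite subr0 => h.
  by apply: le_trans h _; rewrite gerBl ltW.
(* A coordinatewise cluster point of the centres plays the role of their limit; it stays in every
   ball of the sequence by [nle_lim]. *)
have [y hy] := @cluster_cplx _ _ (fun n => (u n).1) bd ub.
have yk k : nle p (y - (u k).1) (u k).2.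
  apply: (nle_lim hp); first exact: ltW.
  move=> s e e0; have [n kn hn] := hy s e k e0; exists ((u n).1 - (u k).1).
    by apply: nle_weak (near _ _ kn) _; rewrite gerBl ltW.
  move=> i si; have := hn i si; rewrite -ncN; congr (_ <= _).
  by congr (nc _); rewrite !fctE; ring.
have [|k Kk] := cover y.
  by apply: (@lp_nle _ _ _ _ 1); have := yk 0%N; rewrite subr0.
by have [_ _ _ /(_ y (yk k.+1))] := us k.
Qed.

End Baire.

(* Balls are compact for coordinatewise convergence, so images of balls are closed
   and Baire's argument gives the open mapping property without any iteration. *)
Lemma tri_open : (beta p (tri a) < +oo)%E ->
  exists2 C : R, 0 <= C & forall (y : cseq R int) (M : R), 0 < M -> im y ->
    nle p y M -> exists2 x, nle p x (C * M) & tri a x = y.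
Proof.
move=> /(dim_quot_basis tri_imageZ)[N [b [lb ib hb]]].
have [|k [r [r0 hr]]] := @some_image_ball N b.
  move=> y /hb[c [x lx xE]].
  have [M M0 xM] := (lpP hp 0 x).1 lx.
  pose S := M + \sum_j nc (c j).
  exists (Num.trunc S).+1, x, c; split.
  - apply: nle_weak xM _; apply: le_trans (ltW (truncnS_gt S)).
    by rewrite lerDl sumr_ge0// => j _; exact: nc_ge0.
  - move=> j; apply: le_trans (ltW (truncnS_gt S)).
    rewrite /S (bigD1 j)//= addrCA lerDl addr_ge0// sumr_ge0// => i _.
    exact: nc_ge0.
  by rewrite xE subrK.
exists (k%:R / r); first by rewrite divr_ge0// ltW.
move=> y M M0 yim yM; pose t := (r / M)%:C%C : Cplx R.
have rM0 : 0 < r / M by rewrite divr_gt0.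
have t0 : t != 0 by rewrite -nc_eq0 nc_real gt_eqF// normr_gt0 gt_eqF.
have [|x [c [xk _ tyE]]] := hr (t *: y).
  have := nleZ hp t (ltW M0) yM; rewrite nc_real gtr0_norm// divfK//.
  by rewrite gt_eqF.
have xl : lp p x by exact: lp_nle xk.
(* Both [t *: y] and [tri a x] lie in the image, hence so does the combination of the [b j], and
   independence modulo the image kills it. *)
have c0 : forall j, c j = 0.
  apply: ib; have -> : \sum_j c j *: b j = t *: y + (-1) *: tri a x.
    by rewrite tyE scaleN1r addrC addKr.
  by apply: tri_imageD; apply: tri_imageZ => //; exists x.
exists (t^-1 *: x).
  have := nleZ hp t^-1 (ler0n _ _) xk; rewrite ncV nc_real gtr0_norm//.
  by congr nle; rewrite invf_div; field; rewrite !gt_eqF.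
apply: (scalerI t0); rewrite triZ scalerA mulfV// scale1r tyE big1 ?addr0//.
by move=> j _; rewrite c0 scale0r.
Qed.

End OpenMapping.

(** * Windows and cutoffs *)

Section Limits.
Variables (R : realType) (p : \bar R).
Hypothesis hp : (1 <= p)%E.

(** Pseudoergodicity relative to a single [A]: arbitrarily many windows of [a] imitate the central
    window of [A]. The distance condition makes windows of radius [n] disjoint. *)
Definition recurs (a A : int -> int -> Cplx R) : Prop :=
  forall (n N : nat) (e : R), 0 < e -> exists k : 'I_N -> int,
    (forall s t, s != t -> (n + n)%:Z < `|k s - k t|) /\
    (forall s (i j : int), `|i| <= n%:Z -> `|j| <= n%:Z ->
       nc (a (k s + i) (k s + j) - A i j) <= e).

Lemma tri_shift (a : int -> int -> Cplx R) (x : cseq R int) k i :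
  tri a x (k + i) = tri (fun i j => a (k + i) (k + j)) (shift (- k) x) i.
Proof.
by rewrite /tri /shift !opprK !addrA [i + k]addrC ![i + _ + k]addrAC ![i + k]addrC.
Qed.

Lemma triDl (a b : int -> int -> Cplx R) (x : cseq R int) :
  tri (fun i j => a i j + b i j) x = tri a x + tri b x.
Proof. by apply/funext => i; rewrite /tri !fctE; ring. Qed.

Lemma sum_scaleE N (d : 'I_N -> Cplx R) (x : 'I_N -> cseq R int) i :
  (\sum_s d s *: x s) i = \sum_s d s * (x s i : Cplx R).
Proof. by rewrite sum_fctE. Qed.

(** In the window of [s0] all the other translates vanish, since the windows are disjoint. *)
Lemma sum_windows N (d : 'I_N -> Cplx R) (x : cseq R int) (k : 'I_N -> int) (n : nat) s0 i :
  (forall s t, s != t -> (n + n)%:Z < `|k s - k t|) ->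
  (forall i : int, n%:Z < `|i| -> x i = 0) ->
  `|i| <= n%:Z ->
  (\sum_s d s *: shift (k s) x) (k s0 + i) = d s0 * (x i : Cplx R).
Proof.
move=> sep x0 hi; rewrite sum_scaleE (bigD1 s0)//= big1.
  by rewrite addr0 /shift addrAC subrr add0r.
move=> s ss; rewrite /shift x0 ?mulr0//.
have := sep _ _ ss; move: hi; clear; lia.
Qed.

Lemma nle_comb N (d : 'I_N -> Cplx R) (x : 'I_N -> cseq R int) (M : R) :
  0 <= M -> (forall s, nc (d s) <= 1) -> (forall s, nle p (x s) M) ->
  nle p (\sum_s d s *: x s) (N%:R * M).
Proof.
move=> M0 d1 xM.
apply: (@nle_weak _ _ _ _ (\sum_(s < N) nc (d s) * M)); last first.
  apply: (@le_trans _ _ (\sum_(s < N) M)).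
    by apply: ler_sum => s _; rewrite ler_piMl.
  by rewrite sumr_const card_ord mulr_natl.
by apply: nle_sum => // s _; [rewrite mulr_ge0// nc_ge0|exact: nleZ].
Qed.

(** Approximate solutions of bounded norm have a coordinatewise cluster point. It solves every
    equation exactly, as each involves only three coordinates, and it inherits the bound. *)
Lemma tri_limit (A : int -> int -> Cplx R) (m B : R) (x : nat -> cseq R int) (y : cseq R int) :
  bdd A m -> 0 <= B -> (forall n, nle p (x n) B) ->
  (forall i e, 0 < e -> exists n0 : nat, forall n, (n0 <= n)%N ->
     nc (tri A (x n) i - y i) <= e) ->
  exists2 z, nle p z B & tri A z = y.
Proof.
move=> Am B0 xB hy.
have [|z hz] := @cluster_cplx _ _ x (fun=> B).
  by move=> n i; exact: nle_coord (xB n).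
exists z.
  apply: (nle_lim hp) => // s e e0; have [n _ hn] := hz s e 0%N e0.
  exists (x n) => // i si; rewrite -ncN opprB; exact: hn.
apply/funext => i; apply/eqP; rewrite -subr_eq0; apply/eqP.
apply: (@nc_arb _ _ (1 + 3 * m)) => e e0.
have [n0 hn0] := hy i e e0.
have [n /hn0 h1 h2] := hz [:: i - 1; i; i + 1] e n0 e0.
have -> : tri A z i - y i = tri A (x n) i - y i + - tri A (x n - z) i.
  by rewrite triB !fctE; ring.
rewrite mulrDl mul1r; apply: le_trans (ncD _ _) _; rewrite ncN lerD//.
apply: nc_tri => // j; rewrite !inE => ij; apply: Am; move: ij; clear; lia.
Qed.

Section Transfer.
Variables (a A : int -> int -> Cplx R) (m : R).
Hypotheses (am : bdd a m) (Am : bdd A m) (aA : recurs a A).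
Hypotheses (afin : (alpha p (tri a) < +oo)%E) (bfin : (beta p (tri a) < +oo)%E).

(* Copies of y in sufficiently many far apart windows of a are dependent modulo
   the image, so some combination of them has a preimage under a; it is a
   preimage of y near one of the windows. *)
Lemma limit_surj : exists2 K : R, 0 <= K & forall (y : cseq R int) (M : R),
  0 < M -> nle p y M -> exists2 x, nle p x (K * M) & tri A x = y.
Proof.
have [C C0 hC] := tri_open hp am bfin.
have [N hN] := dim_quot_dep (@tri_imageZ _ _ hp a) bfin.
exists (C * N.+1%:R) => [|y M M0 yM]; first by rewrite mulr_ge0.
set B := C * N.+1%:R * M.
have B0 : 0 <= B by rewrite !mulr_ge0 ?(ltW M0).
(* Solving the rows [|i| <= n] up to an error of order [1 / n] is enough, because the bound [B] does
   not depend on [n]. *)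
suff /choice[x hx] : forall n : nat, exists x, nle p x B /\
    forall i : int, `|i| <= n%:Z -> nc (tri A x i - y i) <= 3 * n.+1%:R^-1 * B.
  apply: (@tri_limit A m B x) => //; first by move=> n; have [] := hx n.
  move=> i e e0.
  have e'0 : 0 < e / (3 * B + 1) by rewrite divr_gt0// ltr_wpDl// mulr_ge0.
  have [n0 hn0] := invS_le e'0.
  exists (maxn n0 `|i|%N) => n; rewrite geq_max => /andP[/hn0 h1 h2].
  have [_ /(_ i)] := hx n; rewrite -abszE lez_nat h2 => /(_ isT) h.
  apply: le_trans h _; rewrite mulrAC.
  have B30 : 0 <= 3 * B by rewrite mulr_ge0.
  apply: le_trans (ler_wpM2l B30 h1) _.
  rewrite mulrCA ler_piMr ?(ltW e0)// ler_pdivrMr ?mul1r ?lerDl ?ler01//.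
  by rewrite ltr_wpDl.
move=> n; have e0 : 0 < n.+1%:R^-1 :> R by rewrite invr_gt0.
(* Radius [n.+1], because the rows up to [n] reach one column further. *)
have [k [sep hk]] := aA n.+1 N.+1 e0.
pose y0 : cseq R int := restr (fun i : int => `|i| <= n%:Z) y.
have y0M : nle p y0 M by apply: nle_restr => //; exact: ltW.
have sM s : nle p (shift (k s) y0) M by apply: nle_shift => //; exact: ltW.
have [d [dim [s0 ds0] d1]] := hN (fun s => shift (k s) y0) (fun s => lp_nle (sM s)).
have [|x xB xE] := hC _ (N.+1%:R * M) _ dim (nle_comb (ltW M0) d1 sM).
  by rewrite mulr_gt0.
exists (shift (- k s0) x); have x'B : nle p (shift (- k s0) x) B.
  by apply: nle_shift; rewrite /B -?mulrA// !mulr_ge0// ltW.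
split=> // i hi.
have -> : y i = tri a x (k s0 + i).
  rewrite xE (@sum_windows _ d _ _ n s0 i)//; first by rewrite ds0 mul1r /y0 /restr hi.
    by move=> s t /sep; clear; lia.
  by move=> j; rewrite ltNge /y0 /restr => /negPf ->.
rewrite tri_shift.
have -> : tri A (shift (- k s0) x) i - tri (fun i j => a (k s0 + i) (k s0 + j)) (shift (- k s0) x) i
  = tri (fun i j => - (a (k s0 + i) (k s0 + j) - A i j)) (shift (- k s0) x) i.
  by rewrite /tri; ring.
apply: nc_tri => j; last by move=> _; exact: nle_coord x'B.
by rewrite !inE => ij; rewrite ncN; apply: hk; move: hi ij; clear; lia.
Qed.

(** Copies of [x] in far apart windows have images under [a] of norm at most 2M, hence second
    preimages [z s] of norm at most 2CM. The differences lie in the kernel, so [N.+1] of them are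
    dependent. The resulting combination of copies equals one of the [z s], and the window with
    coefficient 1 shows [x] itself. *)
Lemma limit_lower_finite : exists2 K : R, 0 <= K &
  forall (x : cseq R int) (n : nat) (M : R), lp p x ->
    (forall i : int, n%:Z < `|i| -> x i = 0) -> 0 < M ->
    nle p (tri A x) M -> nle p x (K * M).
Proof.
have [C C0 hC] := tri_open hp am bfin.
have [N hN] := dim_quot_dep (Y := [set 0])
  (fun c v (v0 : v = 0) => etrans (congr1 _ v0) (scaler0 _ c)) afin.
exists (N.+1%:R * (C * 2)) => [|x n M lx x0 M0 xM]; first by rewrite !mulr_ge0.
have [X X0 xX] := (lpP hp 0 x).1 lx.
pose w : seq int := [seq i%:Z - n.+1%:Z | i <- iota 0 (n.+1 + n.+2)].
have wP (i : int) : `|i| <= n.+1%:Z -> i \in w.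
  move=> hi; apply/mapP; exists (absz (i + n.+1%:Z)); last by move: hi; clear; lia.
  by rewrite mem_iota; move: hi; clear; lia.
(* The images of [x] under [A] and under a window of [a] differ only on the rows of [w], each time
   by at most [3 * e * X]; this [e] makes the total at most [M]. *)
pose e := M / ((size w)%:R * (3 * X) + 1).
have D0 : 0 < (size w)%:R * (3 * X) + 1 by rewrite ltr_wpDl// !mulr_ge0.
have e0 : 0 < e by rewrite divr_gt0.
have [k [sep hk]] := aA n.+2 N.+1 e0.
have im2 s : nle p (tri a (shift (k s) x)) (M *+ 2).
  have -> : tri a (shift (k s) x) = shift (k s) (tri A x +
      tri (fun i j => a (k s + i) (k s + j) - A i j) x).
    rewrite -triDl; apply/funext => i; rewrite /shift.
    have := tri_shift a (shift (k s) x) (k s) (i - k s).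
    rewrite subrKC => ->; rewrite /tri /shift !opprK !addrK.
    by congr (_ * _ + _ * _ + _ * _); ring.
  apply: nle_shift => //; first by rewrite mulrn_wge0// ltW.
  rewrite mulr2n; apply: nleD => //; try exact: ltW.
  set z := tri _ x.
  have zE : z = restr (mem w) z.
    apply/funext => i; rewrite /restr /=; case: ifPn => // iw.
    have {iw} hi : n.+1%:Z < `|i| by rewrite ltNge; apply: contra iw; exact: wP.
    rewrite /z /tri !x0 ?mulr0 ?addr0//; move: hi; clear; lia.
  have z3 (i : int) : `|i| <= n.+1%:Z -> nc (z i) <= 3 * e * X.
    move=> hi; apply: nc_tri => j; last by move=> _; exact: nle_coord xX.
    by rewrite !inE => ij; apply: hk; move: hi ij; clear; lia.
  rewrite zE; apply: nle_weak (nle_seq hp (c := 3 * e * X) _ _) _.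
  - by rewrite mulr_ge0// mulr_ge0// ltW.
  - by move=> i /mapP[t]; rewrite mem_iota => ht ->; apply: z3; move: ht; clear; lia.
  have -> : (size w)%:R * (3 * e * X) = (size w)%:R * (3 * X) * e by ring.
  rewrite /e mulrCA ler_piMr ?(ltW M0)// ler_pdivrMr// mul1r lerDl//.
have lxs s : lp p (shift (k s) x) by apply: lp_nle (nle_shift hp _ X0 xX).
have M20 : 0 < M *+ 2 by rewrite mulrn_wgt0.
have /choice[z hz] : forall s, exists z, nle p z (C * (M *+ 2)) /\
    tri a z = tri a (shift (k s) x).
  move=> s; have [|z h1 h2] := hC _ _ M20 _ (im2 s); last by exists z.
  by exists (shift (k s) x).
have [|d [dim [s0 ds0] d1]] := hN (fun s => shift (k s) x - z s).
  move=> s; have [h1 h2] := hz s; split; last by rewrite /= triB h2 subrr.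
  rewrite -scaleN1r; apply: lpD => //; first exact: 0.
  by apply: lpZ => //; [exact: 0|exact: lp_nle h1].
have {}dim : \sum_s d s *: shift (k s) x = \sum_s d s *: z s.
  apply/eqP; rewrite -subr_eq0 -sumrB; apply/eqP; rewrite -[RHS]dim.
  by apply: eq_bigr => s _; rewrite scalerBr.
have := nle_comb (x := z) _ d1 (fun s => (hz s).1); rewrite -dim => h.
have CM0 : 0 <= C * (M *+ 2) by rewrite mulr_ge0// ltW.
have -> : N.+1%:R * (C * 2) * M = N.+1%:R * (C * (M *+ 2)) by rewrite -mulr_natr; ring.
apply: (nle_dom hp (g := fun i => k s0 + i)) (h CM0).
- by rewrite mulr_ge0.
- move=> i xi; rewrite (@sum_windows _ d _ _ n s0 i)//; first by rewrite ds0 mul1r.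
    by move=> s t /sep; clear; lia.
  by rewrite leNgt; apply: contra xi => /x0 ->.
- by move=> i j _ _ /addrI.
Qed.

End Transfer.

(** * Slowly varying cutoffs, and invertibility from two-sided estimates *)

Definition mulf (f : int -> R) (x : cseq R int) : cseq R int :=
  fun i => (f i)%:C%C * (x i : Cplx R).

(** The commutator of [A] with multiplication by [f] has entries [A i j] times f j - f i, so it
    feels only the variation of [f] between neighbours. *)
Lemma nle_comm (A : int -> int -> Cplx R) (m d X : R) (f : int -> R) (x : cseq R int) :
  bdd A m -> 0 <= d -> (forall i, `|f (i + 1) - f i| <= d) -> 0 <= X -> nle p x X ->
  nle p (tri A (mulf f x) - mulf f (tri A x)) (3 * (m * d) * X).
Proof.
move=> Am d0 fd X0 xX.
have -> : tri A (mulf f x) - mulf f (tri A x) =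
    tri (fun i j => A i j * ((f j)%:C%C - (f i)%:C%C)) x.
  by apply/funext => i; rewrite /tri /mulf !fctE; ring.
apply: nle_tri => // i j ij; rewrite ncM -rmorphB nc_real ler_pM ?nc_ge0 ?Am//.
have /or3P[/eqP->|/eqP->|/eqP->] : [|| j == i, j == i + 1 | i == j + 1] by lia.
- by rewrite subrr normr0.
- exact: fd.
- by rewrite distrC; exact: fd.
Qed.

Definition clamp (t : R) : R := Num.max 0 (Num.min 1 t).

Lemma clamp_lip s t : `|clamp s - clamp t| <= `|s - t|.
Proof.
have h1 := ler_norm (s - t); have h2 := ler_norm (t - s); rewrite distrC in h2.
rewrite /clamp !maxEle !minEle.
case: (lerP 1 s) => ?; case: (lerP 1 t) => ?; case: (lerP 0 s) => ?;
  case: (lerP 0 t) => ?; rewrite ?ler01 ler_norml; apply/andP; split; lra.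
Qed.

Lemma clamp01 t : 0 <= clamp t <= 1.
Proof. by rewrite /clamp le_max lexx /= ge_max ler01 ge_min lexx. Qed.

Lemma clamp_ge1 t : 1 <= t -> clamp t = 1.
Proof. by move=> t1; rewrite /clamp min_l// max_r. Qed.

Lemma clamp_le0 t : t <= 0 -> clamp t = 0.
Proof. by move=> t0; rewrite /clamp max_l// ge_min t0 orbT. Qed.

Lemma ramp_lip (b c : R) (j i : int) :
  `|clamp (b + c * (absz (i + 1 - j)%R)%:R) - clamp (b + c * (absz (i - j)%R)%:R)| <= `|c|.
Proof.
apply: le_trans (clamp_lip _ _) _.
rewrite opprD addrACA subrr add0r -mulrBr normrM ler_piMr//.
have : (absz (i + 1 - j)%R <= absz (i - j)%R + 1)%N by clear; lia.
have : (absz (i - j)%R <= absz (i + 1 - j)%R + 1)%N by clear; lia.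
rewrite -!(ler_nat R) !natrD ler_norml => h1 h2; apply/andP; split; lra.
Qed.

Lemma nle_mulf (f : int -> R) (x : cseq R int) X :
  (forall i, 0 <= f i <= 1) -> 0 <= X -> nle p x X -> nle p (mulf f x) X.
Proof.
move=> f01 X0 xX; rewrite -[X]mul1r; apply: (@nle_mul _ _ hp (fun i => (f i)%:C%C) id) => //.
by move=> i; rewrite nc_real; have /andP[h1 h2] := f01 i; rewrite ger0_norm.
Qed.

(** A slow cutoff has a commutator term of norm at most [M], so its product with [x] satisfies the
    finite-support estimate with [M + M], whence the factor 2. Widening the cutoff recovers [x]. *)
Lemma lower_lp (A : int -> int -> Cplx R) (m K : R) : bdd A m -> 0 <= K ->
  (forall (x : cseq R int) (n : nat) (M : R), lp p x ->
    (forall i : int, n%:Z < `|i| -> x i = 0) -> 0 < M ->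
    nle p (tri A x) M -> nle p x (K * M)) ->
  forall (x : cseq R int) (M : R), lp p x -> 0 < M ->
    nle p (tri A x) M -> nle p x (K * 2 * M).
Proof.
move=> Am K0 hK x M lx M0 xM.
have m0 : 0 <= m := le_trans (nc_ge0 _) (Am 0 0 isT).
have [X X0 xX] := (lpP hp 0 x).1 lx.
apply: (nle_lim hp) => [|s e e0]; first by rewrite !mulr_ge0// ltW.
have D0 : 0 < 3 * m * X + 1 by rewrite ltr_wpDl// !mulr_ge0.
have [n0 hn0] := invS_le (divr_gt0 M0 D0).
pose L := maxn n0 (\max_(i <- s) `|i|%N).
have L0 : 0 < L.+1%:R :> R by rewrite ltr0n.
(* Equal to 1 up to distance [L.+1] from the origin, to 0 from [2 * L.+1] on, and linear in
   between. *)
pose f (i : int) := clamp (2 + - L.+1%:R^-1 * (absz (i - 0)%R)%:R).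
exists (mulf f x); last first.
  move=> i si; suff -> : mulf f x i = x i by rewrite subrr nc0 ltW.
  rewrite /mulf /f clamp_ge1 ?mul1r//.
  have : `|i|%N%:R <= L.+1%:R :> R.
    rewrite ler_nat; apply: leqW; rewrite leq_max; apply/orP; right.
    exact: (@leq_bigmax_seq _ s (fun=> true) (fun i => `|i|%N)).
  rewrite subr0 mulNr [_^-1 * _]mulrC => h; rewrite -subr_ge0.
  have : `|i|%N%:R / L.+1%:R <= 1 :> R by rewrite ler_pdivrMr// mul1r.
  by move: (_ / _) => q; lra.
have -> : K * 2 * M = K * (M + M) by ring.
apply: (@hK _ (2 * L.+1)%N).
- apply: (@lp_nle _ _ _ _ X); apply: nle_mulf => // i; exact: clamp01.
- move=> i hi; rewrite /mulf /f clamp_le0 ?mul0r//.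
  rewrite subr0 mulNr subr_le0 mulrC ler_pdivlMr// -natrM ler_nat; lia.
- by rewrite addr_gt0.
have -> : tri A (mulf f x) = mulf f (tri A x) + (tri A (mulf f x) - mulf f (tri A x)).
  by rewrite addrC subrK.
apply: nleD; try exact: ltW; first by [].
  by apply: nle_mulf => //; [move=> i; exact: clamp01|exact: ltW].
apply: nle_weak (nle_comm Am _ (ramp_lip _ _ 0) X0 xX) _; first exact: normr_ge0.
rewrite normrN ger0_norm; last by rewrite invr_ge0 ltW.
have h : L.+1%:R^-1 <= M / (3 * m * X + 1) by apply: hn0; rewrite leq_max leqnn.
have -> : 3 * (m * L.+1%:R^-1) * X = 3 * m * X * L.+1%:R^-1 by ring.
apply: le_trans (ler_wpM2l _ h) _; first by rewrite !mulr_ge0.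
by rewrite mulrCA ler_piMr ?(ltW M0)// ler_pdivrMr// mul1r lerDl.
Qed.

(** The lower bound with arbitrarily small [M] gives injectivity. The inverse is a choice of
    preimages, and injectivity makes it linear and bounded by [K]. *)
Lemma tri_invertible (A : int -> int -> Cplx R) (m K K' : R) :
  bdd A m -> 0 <= K -> 0 <= K' ->
  (forall (y : cseq R int) (M : R), 0 < M -> nle p y M ->
     exists2 x, nle p x (K * M) & tri A x = y) ->
  (forall (x : cseq R int) (M : R), lp p x -> 0 < M ->
    nle p (tri A x) M -> nle p x (K' * M)) ->
  invertible p (tri A).
Proof.
move=> Am K0 K'0 surj low.
have inj x y : lp p x -> lp p y -> tri A x = tri A y -> x = y.
  move=> lx ly xy; have ld : lp p (x - y).
    by rewrite -scaleN1r; apply: (lpD hp 0) => //; exact: (lpZ hp 0).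
  have d0 : tri A (x - y) = 0 by rewrite triB xy subrr.
  apply/funext => i; apply/eqP; rewrite -subr_eq0; apply/eqP.
  apply: (@nc_arb _ _ K') => e e0; apply: (nle_coord hp i (x := x - y)).
  by apply: low => //; rewrite d0; exact: nle0 (ltW e0).
have ex y : exists x, lp p y -> lp p x /\ tri A x = y.
  have [/(lpP hp 0)[M M0 yM]|ny] := pselect (lp p y); last by exists 0.
  have M10 : 0 < M + 1 by rewrite ltr_wpDl.
  have [|x xK xE] := surj y _ M10; first by apply: nle_weak yM _; rewrite lerDl.
  by exists x => _; split=> //; exact: lp_nle xK.
have /choice[S hS] := ex.
exists S; last first.
  move=> x lx; have [h1 h2] := hS _ lx; split => //.
  have ltx : lp p (tri A x).
    have [X X0 xX] := (lpP hp 0 x).1 lx.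
    exact: lp_nle (nle_tri hp Am X0 xX).
  by have [h3 h4] := hS _ ltx; apply: inj.
split=> [c x y lx ly|].
  have [h1 h2] := hS _ lx; have [h3 h4] := hS _ ly.
  have lcxy : lp p (c *: x + y) by apply: (lpD hp 0) => //; exact: (lpZ hp 0).
  have [h5 h6] := hS _ lcxy; apply: inj => //.
    by apply: (lpD hp 0) => //; exact: (lpZ hp 0).
  by rewrite h6 triD triZ h2 h4.
exists K => y ly; have [h1 h2] := hS _ ly.
have y0 := lp_norm_ge0 hp y 0.
have yfin : lp_norm p y \is a fin_num by rewrite ge0_fin_numE.
rewrite -(fineK yfin) -EFinM -/(nle _ _ _); set M := fine _.
have M0 : 0 <= M by exact: fine_ge0.
have yM : nle p y M by rewrite /nle /M fineK.
(* [surj] asks for a positive bound while [M] may be 0, hence the margin [e / (K + 1)]. *)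
apply: (nle_adherent) => e e0.
have K10 : 0 < K + 1 by rewrite ltr_wpDl.
have eK0 : 0 < e / (K + 1) by rewrite divr_gt0.
have [||x xK xE] := surj y (M + e / (K + 1)).
- by rewrite ltr_wpDl.
- by apply: nle_weak yM _; rewrite lerDl ltW.
have <- : x = S y by apply: inj => //; [exact: lp_nle xK|rewrite xE h2].
apply: nle_weak xK _; rewrite mulrDr lerD2l mulrCA ler_piMr ?(ltW e0)//.
by rewrite ler_pdivrMr// mul1r lerDl.
Qed.

End Limits.

(** * Compatible triples *)

Section Recurrence.
Variable R : realType.
Variables U V W : set (Cplx R).

Lemma compact_nc_bounded (D : set (Cplx R)) : compact D ->
  exists m : R, forall z, D z -> nc z <= m.
Proof.
move=> Dc.
have cont : continuous (@nc R : Cplx R -> R).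
  move=> z; apply/(@cvgrPdist_le R R _ _ (nbhs_filter (z : Cplx R))) => e e0.
  have E0 : 0 < (e%:C)%C :> Cplx R by rewrite ltcR.
  exists (e%:C)%C => // w; rewrite /ball_ /= ncE ltcR => /ltW zw; apply: le_trans zw.
  have h1 : nc z <= nc (z - w) + nc w by have := ncD (z - w) w; rewrite subrK.
  have h2 : nc w <= nc (z - w) + nc z.
    by have := ncD (w - z) z; rewrite subrK -[nc (w - z)]ncN opprB.
  by rewrite ler_norml; apply/andP; split; lra.
have /compact_bounded[m [_ hm]] : compact (@nc R @` D).
  by apply: continuous_compact => //; exact: continuous_subspaceT.
exists (m + 1) => z Dz; apply: le_trans (ler_norm _) _.
by apply: (hm (m + 1)); [rewrite ltrDl|exists z].
Qed.

Lemma tridiagonal_bounded : compact U -> compact V -> compact W ->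
  exists2 m : R, 0 <= m & forall (I : Type) (pos : I -> int) a,
    tridiagonal U V W pos a -> forall i j, nc (a i j) <= m.
Proof.
move=> /compact_nc_bounded[u hu] /compact_nc_bounded[v hv] /compact_nc_bounded[w hw].
exists (`|u| + `|v| + `|w|) => [|I pos a ha i j]; first by rewrite !addr_ge0.
have [h1 h2 h3 h4] := ha i j.
have nu := normr_ge0 u; have nv := normr_ge0 v; have nw := normr_ge0 w.
have lu := ler_norm u; have lv := ler_norm v; have lw := ler_norm w.
have [/eqP/h1/hu h|/eqP e1] := boolP (pos j == pos i - 1); first lra.
have [/eqP/h2/hv h|/eqP e2] := boolP (pos j == pos i); first lra.
have [/eqP/h3/hw h|/eqP e3] := boolP (pos j == pos i + 1); first lra.
rewrite h4 ?nc0 ?addr_ge0//; move: e1 e2 e3; clear; lia.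
Qed.

Lemma M_bdd a m : (forall i j, nc (a i j) <= m) -> @bdd R a m.
Proof. by move=> h i j _. Qed.

Lemma M_mxop a : Defs.M U V W a -> mxop a = tri a.
Proof. by move=> ha; apply: mxop_tri => i j; have [] := ha i j. Qed.

(** Which of the three sets must contain an entry depends only on its offset from the diagonal, so
    each row may be borrowed from an arbitrary row of [A]. *)
Lemma tridiagonal_rows (A : int -> int -> Cplx R) (I : Type) (pos rho : I -> int) :
  Defs.M U V W A ->
  tridiagonal U V W pos (fun i j => A (rho i) (rho i + (pos j - pos i))).
Proof.
move=> hA i j; have [h1 h2 h3 h4] := hA (rho i) (rho i + (pos j - pos i)).
by split=> e; [apply: h1|apply: h2|apply: h3|apply: h4]; move: e; clear; lia.
Qed.

(* Row i of the matrix is a translate of row rho i of A, so a translation of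
   rho near k copies a window of A to the position k. *)
Lemma recurs_finite (a A : int -> int -> Cplx R) : Defs.M U V W A ->
  (forall (n : nat) (B : 'M[Cplx R]_n) (e : R), (0 < n)%N -> Mfin U V W B -> 0 < e ->
    exists k : int, forall i j : 'I_n, nc (B i j - a (k + i%:Z) (k + j%:Z)) <= e) ->
  recurs a A.
Proof.
move=> MA ha n N e e0; pose L := (n + n).+1.
(* Blocks of length [L], with [rho] running from [- n] to [n] in each and vanishing at the centre
   [s * L + n]. Taking [N.+1] blocks keeps the size positive when [N] is 0. *)
pose rho (i : 'I_(N.+1 * L)) : int := (i %% L)%N%:Z - n%:Z.
pose B : 'M[Cplx R]_(N.+1 * L) := \matrix_(i, j) A (rho i) (rho i + (j%:Z - i%:Z)).
have MB : Mfin U V W B.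
  have h := tridiagonal_rows (fun i : 'I_(N.+1 * L) => i%:Z) rho MA.
  by move=> i j; have := h i j; rewrite /B mxE.
have [//|k hk] := ha _ B e _ MB e0.
exists (fun s : 'I_N => k + (s * L + n)%N%:Z); split=> [s t st|s i j hi hj].
  have : (s : nat) != t by [].
  rewrite -[_ - _]/((k + _) - (k + _)) /L; move: (s : nat) (t : nat); clear => s t st.
  have [lt|lt|e] := ltngtP s t; last by rewrite e eqxx in st.
    have : (s.+1 * (n + n).+1 <= t * (n + n).+1)%N by rewrite leq_mul2r lt orbT.
    by rewrite mulSn; move: (_ * _)%N (_ * _)%N => u v; lia.
  have : (t.+1 * (n + n).+1 <= s * (n + n).+1)%N by rewrite leq_mul2r lt orbT.
  by rewrite mulSn; move: (_ * _)%N (_ * _)%N => u v; lia.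
have idx (l : int) : `|l| <= n%:Z -> exists2 r : 'I_(N.+1 * L),
    (r : nat)%:Z = (s * L + n)%N%:Z + l & rho r = l.
  move=> hl; pose q := absz (n%:Z + l).
  have qL : (q < L)%N by rewrite /q /L; move: hl; clear; lia.
  have qE : q%:Z = n%:Z + l by rewrite /q; move: hl; clear; lia.
  have rN : (s * L + q < N.+1 * L)%N.
    by apply: (@leq_trans (s.+1 * L)%N);
      [rewrite mulSn addnC ltn_add2r|rewrite leq_mul2r ltnS ltnW ?orbT].
  exists (Ordinal rN) => /=; first by rewrite !PoszD qE addrA.
  by rewrite /rho /= modnMDl modn_small// qE; move: qE; clear; lia.
have [I IE rI] := idx i hi; have [J JE rJ] := idx j hj.
have := hk I J; rewrite /B mxE rI IE JE !addrA -ncN opprB; congr (nc (_ - A _ _) <= _).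
by rewrite opprD !addrA; move: (s * L + n)%N; clear; lia.
Qed.

Lemma mx_norm_entry n (B : 'M[Cplx R]_n) (e : R) i j :
  mx_norm B < (e%:C)%C -> nc (B i j) <= e.
Proof.
move=> h; rewrite -lecR -ncE; apply: le_trans (ltW h).
by rewrite /mx_norm -[leLHS]nngE num_le; exact: (le_bigmax _ _ (i, j)).
Qed.

(** The direct sum of [b] with the identity on the negative sites, so that half-line operators fall
    under the two-sided arguments. *)
Definition hext (b : nat -> nat -> Cplx R) (i j : int) : Cplx R :=
  if (0 <= i) && (0 <= j) then b (absz i) (absz j) else (i == j)%:R.

Lemma recurs_PsiE a A : Defs.M U V W A -> PsiE U V W a -> recurs a A.
Proof.
move=> MA [_ ha]; apply: recurs_finite MA _ => n B e n0 MB e0.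
have [k hk] := ha n B e n0 MB e0; exists (k + 1) => i j.
by have := mx_norm_entry i j hk; rewrite !mxE.
Qed.

Lemma recurs_PsiEplus a A : Defs.M U V W A -> PsiEplus U V W a -> recurs (hext a) A.
Proof.
move=> MA [_ ha]; apply: recurs_finite MA _ => n B e n0 MB e0.
have [k hk] := ha n B e n0 MB e0; exists k%:Z => i j.
by have := mx_norm_entry i j hk; rewrite !mxE.
Qed.

(* Centered at the positions 2 ^ t + t, in the dyadic block [2 ^ t, 2 ^ t.+1[. *)
Definition sawtooth (i : int) : int :=
  i - (2 ^ trunc_log 2 (absz i) + trunc_log 2 (absz i))%N%:Z.

Lemma sawtooth_window (n N : nat) : exists k : 'I_N -> int, [/\
    forall s t, s != t -> (n + n)%:Z < `|k s - k t|,
    forall s i, `|i| <= n%:Z -> 0 <= k s + i &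
    forall s i, `|i| <= n%:Z -> sawtooth (k s + i) = i].
Proof.
(* Since 2t < 2^t for t >= 3, a window of radius [n <= T s] around [2 ^ T s + T s] stays in its
   dyadic block, and different windows are far enough apart. *)
pose T (s : 'I_N) := (n + 3 + s)%N.
have big (t : nat) : (2 < t)%N -> (t + t < 2 ^ t)%N.
  by elim: t => [//|[|[|[|t]]] IH]// _; rewrite expnS; have := IH isT; lia.
exists (fun s => (2 ^ T s + T s)%N%:Z); split.
- have sep (s t : 'I_N) : (s < t)%N ->
    (n + n)%:Z < `|(2 ^ T s + T s)%N%:Z - (2 ^ T t + T t)%N%:Z|.
    move=> st; have h := big (T s) (ltac:(by rewrite /T; lia)).
    have h2 : (2 * 2 ^ T s <= 2 ^ T t)%N.
      by rewrite -expnS leq_pexp2l// /T; move: st; clear; lia.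
    have h3 : (n <= T s)%N by rewrite /T -addnA leq_addr.
    have h4 : (T s <= T t)%N by rewrite /T leq_add2l ltnW.
    by move: h h2 h3 h4; move: (2 ^ T s)%N (2 ^ T t)%N (T s) (T t); clear; lia.
  move=> s t st; have : (s : nat) != t by [].
  by case: ltngtP => // lt _; [|rewrite distrC]; exact: sep.
- by move=> s i; rewrite /T; move: (2 ^ _)%N; clear; lia.
move=> s i hi; have h := big (T s) (ltac:(by rewrite /T; lia)).
have h3 : (n <= T s)%N by rewrite /T -addnA leq_addr.
rewrite /sawtooth; have -> : trunc_log 2 (absz ((2 ^ T s + T s)%N%:Z + i)) = T s.
  apply: trunc_log_eq => //; rewrite expnS.
  by move: h h3 hi; move: (2 ^ T s)%N (T s); clear; lia.
by rewrite addrAC subrr add0r.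
Qed.

(** Where compatibility assumes all matrices Fredholm, an operator in which [A] recurs has to be
    supplied. The windows lie on nonnegative sites, so the same matrix serves on the line and on the
    half-line. *)
Lemma recurs_all A : exists a : int -> int -> Cplx R,
  [/\ Defs.M U V W A -> Defs.M U V W a,
      Defs.M U V W A -> Mplus U V W (fun i j => a i%:Z j%:Z),
      recurs a A & recurs (hext (fun i j => a i%:Z j%:Z)) A].
Proof.
pose a i j := A (sawtooth i) (sawtooth i + (j - i)).
have rE (k i j : int) : sawtooth (k + i) = i -> a (k + i) (k + j) = A i j.
  by move=> h; rewrite /a h; congr A; ring.
exists a; split.
- by move=> MA; apply: (tridiagonal_rows id sawtooth MA).
- by move=> MA; apply: (tridiagonal_rows Posz (fun i : nat => sawtooth i) MA).
- move=> n N e e0; have [k [k1 k2 k3]] := sawtooth_window n N.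
  by exists k; split=> // s i j hi hj; rewrite rE ?k3// subrr nc0 ltW.
move=> n N e e0; have [k [k1 k2 k3]] := sawtooth_window n N.
exists k; split=> // s i j hi hj; rewrite /hext !k2//= !gez0_abs ?k2//.
by rewrite rE ?k3// subrr nc0 ltW.
Qed.

End Recurrence.

(** * Half-line operators, and invertibility over a compatible triple *)

Section HalfLine.
Variables (R : realType) (p : \bar R).
Hypothesis hp : (1 <= p)%E.

Lemma mxop_hext (b : nat -> nat -> Cplx R) (z : cseq R int) (n : nat) :
  (forall i j : nat, 1 < `|i%:Z - j%:Z| -> b i j = 0) ->
  mxop b (z \o Posz : cseq R nat) n = tri (hext b) z n%:Z.
Proof.
move=> b0; rewrite /mxop /tri.
(* Row 0 has the additional column -1 in the two-sided form, with entry 0 in [hext b]. *)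
case: n => [|n].
  rewrite (fsbigE [:: 0%N; 1%N]) //=; last first.
    by move=> j _; rewrite !inE => h; rewrite b0 ?mul0r//; move: h; clear; lia.
  rewrite !big_cons big_nil !in_setT /= /hext /=.
  by rewrite !mul0r add0r addr0.
rewrite (fsbigE [:: n; n.+1; n.+2]) //=; last 2 first.
- by rewrite !inE; clear; lia.
- by move=> j _; rewrite !inE => h; rewrite b0 ?mul0r//; move: h; clear; lia.
rewrite !big_cons big_nil !in_setT /= addr0 !addrA.
have -> : n.+1%:Z - 1 = n by clear; lia.
have -> : n.+1%:Z + 1 = n.+2 by clear; lia.
by [].
Qed.

Lemma tri_hext_neg (b : nat -> nat -> Cplx R) (z : cseq R int) (i : int) : i < 0 ->
  tri (hext b) z i = z i.
Proof.
move=> i0; rewrite /tri /hext.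
have -> : (0 <= i) = false by move: i0; clear; lia.
have -> : (i == i - 1) = false by clear; lia.
have -> : (i == i + 1) = false by clear; lia.
by rewrite /= eqxx !mul0r mul1r add0r addr0.
Qed.

Lemma lp_Posz (z : cseq R int) : lp p z -> lp p (z \o Posz : cseq R nat).
Proof.
move=> /(lpP hp 0)[X X0 h]; apply: (@lp_nle _ _ _ _ X).
by apply: (nle_dom hp (g := Posz)) h => // i j _ _ [].
Qed.

Definition zext (x : cseq R nat) : cseq R int :=
  fun i => if 0 <= i then x (absz i) else 0.

Lemma lp_zext (x : cseq R nat) : lp p x -> lp p (zext x).
Proof.
move=> /(lpP hp 0%N)[X X0 h]; apply: (@lp_nle _ _ _ _ X).
apply: (nle_dom hp (g := absz)) h => // [i|i j].
  by rewrite /zext; case: ifP => //; rewrite eqxx.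
rewrite /zext; case: ifP => [i0|]; last by rewrite eqxx.
case: ifP => [j0|]; last by rewrite eqxx.
by move=> _ _; move: i0 j0; clear; lia.
Qed.

Lemma zextK x : zext x \o Posz = x.
Proof. by apply/funext => n. Qed.

Lemma comp_sum n (c : 'I_n -> Cplx R) (b : 'I_n -> cseq R int) :
  (\sum_k c k *: b k) \o Posz = \sum_k c k *: (b k \o Posz : cseq R nat).
Proof.
apply: (big_ind2 (fun (u : cseq R int) (v : cseq R nat) => u \o Posz = v)) => //.
by move=> u u' v v' <- <-.
Qed.

(** Both dimensions transfer by restriction to the nonnegative sites: at negative sites the operator
    is the identity, so null vectors vanish there and a right-hand side is its own preimage. *)
Lemma fredholm_hext (b : nat -> nat -> Cplx R) :
  (forall i j : nat, 1 < `|i%:Z - j%:Z| -> b i j = 0) ->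
  fredholm p (mxop b) -> fredholm p (tri (hext b)).
Proof.
move=> b0 [al be]; split.
  apply: (dim_quot_transfer (f := fun z : cseq R int => z \o Posz : cseq R nat)) al.
  - exact: comp_sum.
  - move=> z [lz Tz]; split; first exact: lp_Posz.
    by apply/funext => n; rewrite mxop_hext// Tz.
  move=> n c v hv /= h0; apply/funext => i.
  have [i0|i0] := leP 0 i.
    by have := congr1 (fun x => x (absz i)) h0; rewrite /= gez0_abs.
  have : tri (hext b) (\sum_k c k *: v k) i = 0.
    by rewrite tri_sum big1// => k _; have [_ ->] := hv k; rewrite scaler0.
  by rewrite tri_hext_neg.
apply: (dim_quot_transfer (f := fun z : cseq R int => z \o Posz : cseq R nat)) be.
- exact: comp_sum.
- exact: lp_Posz.
move=> n c v lv [x lx xE]; set y := \sum_k c k *: v k.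
have ly : lp p y by apply: (lp_sum hp 0) => k _; exact: (lpZ hp 0).
exists (zext x + restr (fun i : int => i < 0) y).
  apply: (lpD hp 0); first exact: lp_zext.
  have [Y Y0 yY] := (lpP hp 0 y).1 ly.
  exact: lp_nle (nle_restr hp _ Y0 yY).
apply/funext => i; have [i0|i0] := leP 0 i.
  case: i i0 => // i _; rewrite -mxop_hext//.
  have -> : (zext x + restr (fun i : int => i < 0) y) \o Posz = x.
    by apply/funext => k; rewrite /= !fctE /restr /= addr0.
  by rewrite xE.
rewrite tri_hext_neg// !fctE /zext /restr i0 leNgt i0 /=; exact: add0r.
Qed.

Lemma invertible_lp (I : choiceType) (i0 : I) (S : cseq R I -> cseq R I) y :
  bounded_operator p S -> lp p y -> lp p (S y).
Proof.
move=> [_ [K hK]] ly; have y0 := lp_norm_ge0 hp y i0.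
have yfin : lp_norm p y \is a fin_num by rewrite ge0_fin_numE.
by have := hK y ly; rewrite -(fineK yfin) -EFinM; exact: lp_nle.
Qed.

Lemma invertible_fredholm (a : int -> int -> Cplx R) :
  invertible p (tri a) -> fredholm p (tri a).
Proof.
move=> [S bS hS].
split.
  apply: (@dim_quot_le1 _ _ _ _ _ 0).
  - by move=> c v /= ->; rewrite scaler0.
  - by move=> u v /= -> ->; rewrite addr0.
  move=> x [lx /= Tx]; exists 0; rewrite scaler0 subr0 /=.
  have [_ <-] := hS x lx; rewrite Tx.
  by have [_ +] := hS 0 (lp0 hp _); rewrite tri0.
apply: (@dim_quot_le1 _ _ _ _ _ 0).
- exact: (tri_imageZ hp).
- exact: (tri_imageD hp).
move=> y ly; exists 0; rewrite scaler0 subr0; exists (S y).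
  exact: (invertible_lp 0 bS).
by have [] := hS y ly.
Qed.

Lemma fredholm_limit (a A : int -> int -> Cplx R) m : bdd a m -> bdd A m ->
  recurs a A -> fredholm p (tri a) -> invertible p (tri A).
Proof.
move=> am Am aA [al be].
have [K K0 hK] := limit_surj hp am Am aA be.
have [K' K'0 hK'] := limit_lower_finite hp am aA al be.
apply: (tri_invertible hp Am K0 _ hK (lower_lp hp Am K'0 hK')).
by rewrite mulr_ge0.
Qed.

Lemma compatible_invertible (U V W : set (Cplx R)) :
  compact U -> compact V -> compact W -> compatible U V W p ->
  forall A, Defs.M U V W A -> invertible p (tri A).
Proof.
move=> Uc Vc Wc comp A MA.
have [m m0 hm] := tridiagonal_bounded Uc Vc Wc.
(* The maximum with 1 accounts for the diagonal ones of [hext] at negative sites. *)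
pose m1 := Num.max m 1.
have bM a : Defs.M U V W a -> bdd a m1.
  by move=> Ma i j _; rewrite le_max (hm _ _ _ Ma).
have bh b : Mplus U V W b -> bdd (hext b) m1.
  move=> Mb i j _; rewrite /hext; case: ifP => _; first by rewrite le_max (hm _ _ _ Mb).
  by case: eqP => _; rewrite le_max ?nc1 ?lexx ?orbT// nc0 m0.
have b0 b : Mplus U V W b -> forall i j : nat, 1 < `|i%:Z - j%:Z| -> b i j = 0.
  by move=> Mb i j; have [] := Mb i j.
have [a' [Ma' Mb' ra' rb']] := recurs_all U V W A.
case: comp => [[a Pa]|[a Pa]|h|[h|[a Pa]|h]].
- have [Ma _] := Pa; rewrite (M_mxop Ma).
  exact: fredholm_limit (bM _ Ma) (bM _ MA) (recurs_PsiE MA Pa).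
- have [Ma _] := Pa; rewrite (M_mxop Ma) => /invertible_fredholm.
  exact: fredholm_limit (bM _ Ma) (bM _ MA) (recurs_PsiE MA Pa).
- have := h _ (Ma' MA); rewrite (M_mxop (Ma' MA)).
  exact: fredholm_limit (bM _ (Ma' MA)) (bM _ MA) ra'.
- by have := h _ MA; rewrite (M_mxop MA).
- have [Ma _] := Pa; move/(fredholm_hext (b0 _ Ma)).
  exact: fredholm_limit (bh _ Ma) (bM _ MA) (recurs_PsiEplus MA Pa).
have := fredholm_hext (b0 _ (Mb' MA)) (h _ (Mb' MA)).
exact: fredholm_limit (bh _ (Mb' MA)) (bM _ MA) rb'.
Qed.

End HalfLine.

(** * Exponential decay *)

Section Decay.
Variables (R : realType) (p : \bar R).
Hypothesis hp : (1 <= p)%E.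

Definition delta (j : int) : cseq R int := fun i => (i == j)%:R.

Lemma nle_delta j : nle p (delta j) 1.
Proof.
rewrite -(nc1 R) -[X in nc X]/(((true : nat)%:R) : Cplx R) -(eqxx j).
by apply: nle_point => // i /negPf ij; rewrite /delta ij.
Qed.

(** Let [f] vanish up to distance [n * L.+1] from [j] and be 1 from [n.+1 * L.+1] on. Multiplying
    [tri A G'] by [f] gives 0, so the image of the product of [f] and [G'] is a pure commutator; for
    a slow ramp the lower bound halves the norm at each step. The width depends only on [m] and [K],
    hence not on [j]. *)
Lemma delta_decay (A : int -> int -> Cplx R) (m K : R) : bdd A m -> 0 <= K ->
  (forall (x : cseq R int) M, lp p x -> 0 <= M -> nle p (tri A x) M -> nle p x (K * M)) ->
  exists L : nat, forall (j : int) (G : cseq R int), lp p G -> tri A G = delta j ->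
    forall (n : nat) i, (n * L.+1 <= absz (i - j)%R)%N -> nc (G i) <= K / 2 ^+ n.
Proof.
move=> Am K0 low.
have m0 : 0 <= m := le_trans (nc_ge0 _) (Am 0 0 isT).
(* Chosen so that [K] times the commutator constant [3 * m / L.+1] is at most one half. *)
have e0 : 0 < (6 * m * K + 1)^-1 by rewrite invr_gt0 ltr_wpDl// !mulr_ge0.
have [L hL] := invS_le e0; exists L => j G lG GE n i hi.
pose P (n : nat) (i : int) := (n * L.+1 <= absz (i - j)%R)%N.
suff main : nle p (restr (P n) G) (K / 2 ^+ n).
  by have := nle_coord hp i main; rewrite /restr /P hi.
elim: n {i hi} => [|n IH].
  rewrite expr0 divr1; apply: nle_restr => //; rewrite -[K]mulr1.
  by apply: low => //; rewrite GE; exact: nle_delta.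
have X0 : 0 <= K / 2 ^+ n by rewrite divr_ge0// exprn_ge0.
set G' := restr (P n) G in IH *.
pose f (i : int) : R := clamp (- n%:R + L.+1%:R^-1 * (absz (i - j)%R)%:R).
have L0 : 0 < L.+1%:R :> R by rewrite ltr0n.
have f0 i : (absz (i - j)%R <= n * L.+1)%N -> f i = 0.
  move=> h; rewrite /f clamp_le0// addrC subr_le0 mulrC ler_pdivrMr//.
  by rewrite -natrM ler_nat.
have f1 i : P n.+1 i -> f i = 1.
  move=> h; rewrite /f clamp_ge1// addrC lerBrDr nat1r mulrC ler_pdivlMr//.
  by rewrite -natrM ler_nat.
(* Where [f] is nonzero the distance exceeds [n * L.+1], so the neighbours are still in the region
   where [G'] equals [G], and the site is not [j]. *)
have fT : mulf f (tri A G') = 0.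
  apply/funext => i; rewrite /mulf.
  have [/f0 ->|h] := leqP (absz (i - j)%R) (n * L.+1); first by rewrite mul0r.
  suff -> : tri A G' i = 0 by rewrite mulr0.
  have <- : delta j i = 0.
    rewrite /delta; case: eqP => // ij; move: h.
    by rewrite ij subrr ltn0.
  by rewrite -GE /tri /G' /restr /P !ifT//; move: h; move: (n * _)%N; clear; lia.
have L'0 : 0 <= L.+1%:R^-1 :> R by rewrite invr_ge0 ltW.
have fl i : `|f (i + 1) - f i| <= L.+1%:R^-1.
  by rewrite -[leRHS]ger0_norm//; exact: ramp_lip.
have := nle_comm hp (f := f) Am L'0 fl X0 IH.
rewrite fT subr0.
have lf : lp p (mulf f G').
  by apply: (@lp_nle _ _ _ _ (K / 2 ^+ n)); apply: nle_mulf => // i; exact: clamp01.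
move=> /(low _ _ lf) h.
have {h} h : nle p (mulf f G') (K / 2 ^+ n.+1).
  apply: nle_weak (h _) _; first by rewrite !mulr_ge0 ?invr_ge0 ?(ltW L0).
  have -> : K * (3 * (m * L.+1%:R^-1) * (K / 2 ^+ n)) =
      (6 * m * K * L.+1%:R^-1) * (K / 2 ^+ n.+1).
    by rewrite exprS invfM; field; rewrite expf_neq0// ?pnatr_eq0// gt_eqF.
  rewrite ler_piMl ?divr_ge0 ?exprn_ge0//.
  have c0 : 0 <= 6 * m * K by rewrite !mulr_ge0.
  apply: le_trans (ler_wpM2l c0 (hL L (leqnn L))) _.
  by rewrite ler_pdivrMr ?mul1r ?lerDl// ltr_wpDl.
apply: (nle_dom hp (g := id)) h => //; first by rewrite divr_ge0// exprn_ge0.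
move=> i; rewrite /restr; case: ifP => [hi _|_]; last by rewrite eqxx.
rewrite /mulf (f1 _ hi) mul1r /G' /restr ifT//.
by apply: leq_trans hi; rewrite leq_mul2r leqnSn orbT.
Qed.

(** A shell of width [L.+1] has at most 2(L + 1) sites, so the triangle inequality bounds its part
    of [x] by [D / 2 ^+ n], whatever the exponent. *)
Lemma lp_decay (x : cseq R int) (L : nat) (K : R) : 0 <= K ->
  (forall (n : nat) i, (n * L.+1 <= absz i)%N -> nc (x i) <= K / 2 ^+ n) -> lp p x.
Proof.
move=> K0 hx; pose D := (L.+1 + L.+1)%:R * K.
have D0 : 0 <= D by rewrite mulr_ge0.
pose P (n : nat) (i : int) := (absz i < n * L.+1)%N.
(* [D * (2 - 2 / 2 ^+ n)] is the geometric sum of the bounds of the first [n] shells. *)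
have part n : nle p (restr (P n) x) (D * (2 - 2 / 2 ^+ n)).
  elim: n => [|n IH].
    rewrite expr0 divr1 subrr mulr0.
    have -> : restr (P 0%N) x = 0 by apply/funext => i; rewrite /restr /P mul0n ltn0.
    exact: nle0.
  pose w : seq int := [seq (n * L.+1 + i)%N%:Z | i <- iota 0 L.+1]
    ++ [seq - (n * L.+1 + i)%N%:Z | i <- iota 0 L.+1].
  have -> : restr (P n.+1) x = restr (P n) x
      + restr (mem w) (restr (fun i => P n.+1 i && ~~ P n i) x).
    apply/funext => i; rewrite !fctE /restr /=.
    case: ifPn => [Pi|nPi]; case: ifPn => [Pi'|nPi']; rewrite ?andbT ?andbF /= ?if_same ?addr0//.
      rewrite ifT ?add0r// mem_cat; move: Pi nPi'; rewrite /P -leqNgt => Pi Pi'.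
      have hr : (absz i - n * L.+1 < L.+1)%N by rewrite ltn_subLR// addnC -mulSn.
      apply/orP; case: (leP 0 i) => i0; [left|right]; apply/mapP;
        exists (absz i - n * L.+1)%N; rewrite ?mem_iota// subnKC//; move: i0; clear; lia.
    by case/negP: nPi; apply: leq_trans Pi' _; rewrite leq_mul2r leqnSn orbT.
  have e2 : 0 < 2 ^+ n :> R by rewrite exprn_gt0.
  have step : nle p (restr (mem w) (restr (fun i => P n.+1 i && ~~ P n i) x)) (D / 2 ^+ n).
    have -> : D / 2 ^+ n = (size w)%:R * (K / 2 ^+ n).
      by rewrite /w size_cat !size_map size_iota /D mulrA.
    have Kn : 0 <= K / 2 ^+ n by rewrite divr_ge0// ltW.
    apply: nle_seq => // i _; rewrite /restr; case: ifP => [/andP[_]|]; last by rewrite nc0.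
    by rewrite /P -leqNgt; exact: hx.
  have -> : D * (2 - 2 / 2 ^+ n.+1) = D * (2 - 2 / 2 ^+ n) + D / 2 ^+ n.
    by rewrite exprS; field; rewrite gt_eqF.
  apply: nleD => //; last by rewrite divr_ge0// ltW.
  rewrite mulr_ge0// subr_ge0 ler_pdivrMr// ler_peMr// exprn_ege1// ler1n//.
apply: (@lp_nle _ _ _ _ (D * 2)); apply: (nle_lim hp) => [|s e e0]; first by rewrite mulr_ge0.
pose n := (\max_(i <- s) absz i).+1.
exists (restr (P n) x).
  apply: nle_weak (part n) _; rewrite ler_wpM2l// gerBl divr_ge0// exprn_ge0//.
move=> i si; rewrite /restr ifT ?subrr ?nc0 ?ltW// /P mulnS.
apply: leq_trans (leq_addr _ _); rewrite ltnS.
exact: (@leq_bigmax_seq _ s (fun=> true) absz).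
Qed.

End Decay.

(** * Coburn's argument *)

Section Coburn.
Variables (R : realType) (p : \bar R).
Hypothesis hp : (1 <= p)%E.
Variables U V W : set (Cplx R).
Variables u v w : Cplx R.
Hypotheses (Uu : U u) (Vv : V v) (Ww : W w).
Hypotheses (Uc : compact U) (Vc : compact V) (Wc : compact W).
Hypothesis inv : forall A, Defs.M U V W A -> invertible p (tri A).

(** A filler with constant diagonals, for the entries that [B] does not prescribe. *)
Definition toeplitz (i j : int) : Cplx R :=
  if j == i - 1 then u else if j == i then v else if j == i + 1 then w else 0.

Lemma invertible_lower (A : int -> int -> Cplx R) S : bounded_operator p S ->
  (forall x, lp p x -> tri A (S x) = x /\ S (tri A x) = x) ->
  (forall x, lp p x -> lp p (tri A x)) ->
  exists2 K : R, 0 <= K & forall (x : cseq R int) M, lp p x -> 0 <= M ->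
    nle p (tri A x) M -> nle p x (K * M).
Proof.
move=> [_ [K hK]] hS lA; exists `|K| => // x M lx M0 xM.
have [_ e] := hS x lx; rewrite -{1}e.
have ly := lA x lx; have y0 := lp_norm_ge0 hp (tri A x) 0.
have yfin : lp_norm p (tri A x) \is a fin_num by rewrite ge0_fin_numE.
have := hK _ ly; rewrite -(fineK yfin) -EFinM => h; apply: nle_weak h _.
have f0 : 0 <= fine (lp_norm p (tri A x)) by exact: fine_ge0.
apply: le_trans (ler_wpM2r f0 (ler_norm K)) _; rewrite ler_wpM2l//.
by rewrite -lee_fin fineK.
Qed.

Variable B : nat -> nat -> Cplx R.
Hypothesis MB : Mplus U V W B.

Let B0 (i j : nat) : 1 < `|i%:Z - j%:Z| -> B i j = 0.
Proof. by have [] := MB i j. Qed.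

(** Unlike [hext B], this extension has its entries in the three sets, so it is one of the matrices
    known to be invertible. *)
Definition glue (i j : int) : Cplx R :=
  if (0 <= i) && (0 <= j) then B (absz i) (absz j) else toeplitz i j.
Local Notation A := glue.

Lemma toeplitz_tridiagonal : tridiagonal U V W id toeplitz.
Proof.
move=> i j; rewrite /toeplitz; split=> e.
- by rewrite ifT//; move: e => /=; clear; lia.
- by rewrite 1?ifF ?ifT//; move: e => /=; clear; lia.
- by rewrite 2?ifF ?ifT//; move: e => /=; clear; lia.
- by rewrite !ifF//; move: e => /=; clear; lia.
Qed.

Lemma glue_M : Defs.M U V W A.
Proof.
move=> i j; rewrite /glue; case: ifP => [/andP[i0 j0]|_]; last exact: toeplitz_tridiagonal.
by have := MB (absz i) (absz j); rewrite !gez0_abs.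
Qed.

Lemma glue_right (z : cseq R int) (n : nat) :
  tri A z n%:Z = mxop B (z \o Posz : cseq R nat) n
    + (n == 0%N)%:R * (u * (z (-1) : Cplx R)).
Proof.
rewrite (mxop_hext _ _ B0) /tri /hext /glue.
case: n => [|n]; first by rewrite /toeplitz /= !mul0r !add0r mul1r; ring.
have e : (0 <= n.+1%:Z - 1) = true by clear; lia.
by rewrite e /= mul0r addr0.
Qed.

Lemma glue_left (x : cseq R nat) (i : int) : i < 0 ->
  tri A (zext x) i = (i == -1)%:R * (w * (x 0%N : Cplx R)).
Proof.
move=> i0; rewrite /tri /zext /glue.
have -> : (0 <= i) = false by move: i0; clear; lia.
have -> : (0 <= i - 1) = false by move: i0; clear; lia.
have [->|i1] := eqVneq i (-1).
  by rewrite /toeplitz /= !mulr0 !add0r mul1r.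
have -> : (0 <= i + 1) = false by move: i0 i1; clear; lia.
by rewrite !mulr0 !addr0 mul0r.
Qed.

(** Row -1 alone is disturbed, through its entry [w] at site 0. Thus the extended null vectors are
    multiples of column -1 of the inverse. *)
Lemma glue_ker (x : cseq R nat) : mxop B x = 0 ->
  tri A (zext x) = (w * (x 0%N : Cplx R)) *: delta R (-1).
Proof.
move=> Bx; apply/funext => i.
change (tri A (zext x) i = w * (x 0%N : Cplx R) * (i == -1)%:R).
have [i0|i0] := leP 0 i; last by rewrite glue_left// mulrC.
case: i i0 => // n _; rewrite glue_right zextK Bx.
have -> : zext x (-1) = 0 by [].
by rewrite !mulr0 addr0.
Qed.

Variable S : cseq R int -> cseq R int.
Hypothesis bS : bounded_operator p S.
Hypothesis hS : forall x, lp p x -> tri A (S x) = x /\ S (tri A x) = x.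

Let lpS y : lp p y -> lp p (S y).
Proof. exact: (invertible_lp hp 0 bS). Qed.

Let ldelta j : lp p (delta R j).
Proof. exact: lp_nle (nle_delta hp j). Qed.

Let SZ c x : lp p x -> S (c *: x) = c *: S x.
Proof.
move=> lx; have [lin _] := bS; have l0 := lp0 hp int.
have S0 : S 0 = 0 by have [_] := hS l0; rewrite tri0.
by have := lin c x 0 lx l0; rewrite addr0 S0 addr0.
Qed.

Let SD x y : lp p x -> lp p y -> S (x + y) = S x + S y.
Proof. by move=> lx ly; have := bS.1 1 x y lx ly; rewrite !scale1r. Qed.

(** Restricting the two-sided solution to the half-line drops its value at -1, which enters row 0
    with coefficient [u]; no other row notices. *)
Lemma half_image (y : cseq R nat) : lp p y ->
  (mxop B @` lp p) (y - (u * (S (zext y) (-1) : Cplx R)) *: (delta R 0 \o Posz : cseq R nat)).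
Proof.
move=> ly; have lz := lp_zext hp ly; have [e _] := hS lz.
exists (S (zext y) \o Posz); first exact: (lp_Posz hp) (lpS lz).
apply/funext => n.
have := congr1 (fun x => x n%:Z) e; rewrite glue_right.
have -> : zext y n = y n by [].
move=> yE; apply: esym.
change ((y n : Cplx R) - u * (S (zext y) (-1) : Cplx R) * (n == 0)%:R
  = mxop B (S (zext y) \o Posz) n).
by rewrite -yE; ring.
Qed.

Lemma mxopZD (c : Cplx R) (x y : cseq R nat) :
  mxop B (c *: x + y) = c *: mxop B x + mxop B y.
Proof.
apply/funext => n; have e z : mxop B z n = tri (hext B) (zext z) n.
  by rewrite -(mxop_hext _ _ B0) zextK.
have -> : mxop B (c *: x + y) n = (tri (hext B) (c *: zext x + zext y)) n.
  rewrite e; congr (tri _ _ _); apply/funext => i.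
  rewrite !fctE /zext; case: ifP => // _; change (0 = c * 0 + 0 :> Cplx R); ring.
by rewrite triD triZ !fctE !e.
Qed.

Let mxop0 : mxop B 0 = 0.
Proof. by have := mxopZD (-1) 0 0; rewrite !scaleN1r oppr0 addr0 addNr. Qed.

Lemma half_fredholm : fredholm p (mxop B).
Proof.
split.
  apply: (@dim_quot_le1 _ _ _ _ _ (S (delta R (-1)) \o Posz)).
  - by move=> c z /= ->; rewrite scaler0.
  - by move=> x y /= -> ->; rewrite addr0.
  move=> x [lx /= Bx]; exists (w * (x 0%N : Cplx R)).
  have [_] := hS (lp_zext hp lx); rewrite glue_ker// SZ// => e.
  by apply/eqP; rewrite subr_eq0; apply/eqP; rewrite -[LHS]zextK -e.
apply: (@dim_quot_le1 _ _ _ _ _ (delta R 0 \o Posz)).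
- move=> c y [x lx <-]; exists (c *: x); first exact: (lpZ hp 0%N).
  by have := mxopZD c x 0; rewrite mxop0 !addr0.
- move=> y y' [x lx <-] [x' lx' <-]; exists (x + x'); first exact: (lpD hp 0%N).
  by have := mxopZD 1 x x'; rewrite !scale1r.
by move=> y ly; exists (u * (S (zext y) (-1) : Cplx R)); exact: half_image.
Qed.

(** Row -1 of the inverse of [A]. *)
Let th (i : int) : Cplx R := S (delta R i) (-1).

(** This is S (A delta_k) = delta_k read at site -1, where delta_k vanishes for k >= 0; column [k]
    of [A] has three entries. *)
Lemma th_rel (k : int) : 0 <= k ->
  A (k - 1) k * th (k - 1) + A k k * th k + A (k + 1) k * th (k + 1) = 0.
Proof.
move=> k0; have [_ e] := hS (ldelta k).
have Ad : tri A (delta R k) = A (k - 1) k *: delta R (k - 1)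
    + A k k *: delta R k + A (k + 1) k *: delta R (k + 1).
  apply/funext => i.
  change (A i (i - 1) * (i - 1 == k)%:R + A i i * (i == k)%:R + A i (i + 1) * (i + 1 == k)%:R
    = A (k - 1) k * (i == k - 1)%:R + A k k * (i == k)%:R + A (k + 1) k * (i == k + 1)%:R).
  have -> : (i - 1 == k) = (i == k + 1) by rewrite subr_eq.
  have -> : (i + 1 == k) = (i == k - 1) by rewrite eq_sym -subr_eq eq_sym.
  have [->|n1] := eqVneq i (k + 1).
    have -> : (k + 1 == k) = false by clear; lia.
    have -> : (k + 1 == k - 1) = false by clear; lia.
    by rewrite addrK /=; ring.
  have [->|n2] := eqVneq i k.
    have -> : (k == k - 1) = false by clear; lia.
    by rewrite /=; ring.
  have [->|n3] := eqVneq i (k - 1); last by rewrite /=; ring.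
  by rewrite subrK /=; ring.
have lZ c j : lp p (c *: delta R j) by exact: (lpZ hp 0).
move: e; rewrite Ad !SD// ?SZ//; last exact: (lpD hp 0).
move=> /(congr1 (fun x => x (-1))) e; apply: etrans e _.
rewrite /delta; have -> // : (-1 == k) = false by move: k0; clear; lia.
Qed.

(* The reflected transpose of B on the left of the site 0, and B on its right. *)
Definition center (i j : int) : Cplx R :=
  if (1 <= i) && (1 <= j) then B (absz (i - 1)%R) (absz (j - 1)%R)
  else if (i < 0) && (j < 0) then B (absz (-1 - j)%R) (absz (-1 - i)%R)
  else toeplitz i j.

Lemma center_M : Defs.M U V W center.
Proof.
move=> i j; rewrite /center; case: ifPn => [/andP[i0 j0]|_].
  have [h1 h2 h3 h4] := MB (absz (i - 1)%R) (absz (j - 1)%R).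
  by split=> /= e; [apply: h1|apply: h2|apply: h3|apply: h4]; move: e i0 j0; clear; lia.
case: ifPn => [/andP[i0 j0]|_]; last exact: toeplitz_tridiagonal.
have [h1 h2 h3 h4] := MB (absz (-1 - j)%R) (absz (-1 - i)%R).
by split=> /= e; [apply: h1|apply: h2|apply: h3|apply: h4]; move: e i0 j0; clear; lia.
Qed.

Let center_right (i j : int) : 1 <= i -> 1 <= j -> center i j = A (i - 1) (j - 1).
Proof.
move=> i0 j0; rewrite /center /glue i0 j0 /= ifT//.
by move: i0 j0; clear; lia.
Qed.

Let center_left (i j : int) : i < 0 -> j < 0 -> center i j = A (-1 - j) (-1 - i).
Proof.
move=> i0 j0; rewrite /center /glue ifF; last by move: i0; clear; lia.
by rewrite i0 j0 /= ifT//; move: i0 j0; clear; lia.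
Qed.

Lemma coburn : alpha p (mxop B) = 0%E \/ beta p (mxop B) = 0%E.
Proof.
apply: contrapT => /not_orP[/dim_quot_neq0[x [lx /= Bx] x0] /dim_quot_neq0[y ly nBy]].
have [m m0 hm] := tridiagonal_bounded Uc Vc Wc.
have Am : bdd A m := M_bdd (hm _ _ _ glue_M).
have lA z : lp p z -> lp p (tri A z).
  by move=> /(lpP hp 0)[X X0 zX]; exact: lp_nle (nle_tri hp Am X0 zX).
have [K K0 low] := invertible_lower bS hS lA.
have [L decay] := delta_decay hp Am K0 low.
have inj z : lp p z -> tri A z = 0 -> z = 0.
  move=> lz Az; have [_ <-] := hS lz; rewrite Az -(scale0r 0) SZ ?scale0r//; exact: lp0.
(* Otherwise [zext x] would be a nonzero null vector of the invertible [A]. *)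
have wx0 : w * (x 0%N : Cplx R) != 0.
  apply/eqP => wx; apply: x0; rewrite /= -[x]zextK (inj (zext x))//; first exact: lp_zext.
  by rewrite glue_ker// wx scale0r.
(* [zext x] is a nonzero multiple of column -1 of the inverse and vanishes at -1. Hence the entries
   of [th] from 0 on form a null vector of the transpose of [B]. *)
have thm1 : th (-1) = 0.
  have [_] := hS (lp_zext hp lx); rewrite glue_ker// SZ// => /(congr1 (fun z => z (-1))).
  change (w * (x 0%N : Cplx R) * th (-1) = 0 -> th (-1) = 0).
  by move=> /eqP; rewrite mulf_eq0 (negPf wx0) => /eqP.
have imB c z : (mxop B @` lp p) z -> (mxop B @` lp p) (c *: z).
  move=> [x' lx' <-]; exists (c *: x'); first exact: (lpZ hp 0%N).
  by have := mxopZD c x' 0; rewrite mxop0 !addr0.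
(* Otherwise delta_0 would be in the image of [B], and [y], which is in the image up to a multiple
   of delta_0, would be too. *)
have th0 : th 0 != 0.
  apply/eqP => th0; apply: nBy.
  have de : zext (delta R 0 \o Posz) = delta R 0.
    apply/funext => i; rewrite /zext /delta /=; case: ifP => i0; first by rewrite gez0_abs.
    by case: eqP => // ii; move: i0; rewrite ii.
  have := half_image (lp_Posz hp (ldelta 0)); rewrite de -/(th 0) th0 mulr0 scale0r subr0.
  move=> /(imB (u * (S (zext y) (-1) : Cplx R))) [z lz zE].
  have [z' lz' z'E] := half_image ly.
  exists (z + z'); first exact: (lpD hp 0%N).
  by have := mxopZD 1 z z'; rewrite !scale1r => ->; rewrite zE z'E addrC subrK.
pose y' : cseq R int := fun i => if i < 0 then th (-1 - i) else 0.
(* Each entry of this row is read in its own column, at distance [|i|] from the diagonal; the decay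
   of columns is uniform, so the row decays too. *)
have ly' : lp p y'.
  apply: (lp_decay hp K0 (L := L)) => n i hi; rewrite /y'; case: ifPn => i0; last first.
    by rewrite nc0 divr_ge0// exprn_ge0.
  have [e _] := hS (ldelta (-1 - i)); apply: decay (lpS (ldelta _)) e _ _ _.
  by apply: leq_trans hi _; clear; lia.
(* Row 0 of [center] reads u s th(0) + w t x(0), since [z] vanishes at 0; these values of [s] and
   [t] cancel it. *)
pose s := w * (x 0%N : Cplx R); pose t := - (u * th 0).
pose z : cseq R int := s *: y' + t *: shift 1 (zext x).
have zE i : z i = s * (y' i : Cplx R) + t * (zext x (i - 1) : Cplx R) by [].
have zneg (i : int) : i < 0 -> z i = s * th (-1 - i).
  move=> i0; rewrite zE /y' i0 /zext ifF ?mulr0 ?addr0//; move: i0; clear; lia.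
have zpos (i : int) : 0 <= i -> z i = t * (zext x (i - 1) : Cplx R).
  by move=> i0; rewrite zE /y' ltNge i0 mulr0 add0r.
have z0 : z 0 = 0 by rewrite zpos// /zext /= mulr0.
have lz : lp p z.
  apply: (lpD hp 0); apply: (lpZ hp 0) => //.
  have [X X0 xX] := (lpP hp 0 (zext x)).1 (lp_zext hp lx).
  exact: lp_nle (nle_shift hp 1 X0 xX).
have [S' _ hS'] := inv center_M.
(* Invertibility would force [z] to be 0, whereas its value at -1 is [s * th 0], a product of
   nonzero factors. *)
suff Az0 : tri center z = 0.
  have [_ +] := hS' _ lz; rewrite Az0 => zS.
  have [_ +] := hS' _ (lp0 hp _); rewrite tri0 zS => /(congr1 (fun f => f (-1))).
  rewrite zneg// => /eqP; rewrite (_ : _ - -1 = 0)//.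
  by rewrite mulf_eq0 (negPf wx0) (negPf th0).
apply/funext => i; change (tri center z i = 0 :> Cplx R); have [i0|i0] := ltP i 0.
  have k0 : 0 <= -1 - i by move: i0; clear; lia.
  have := congr1 (fun c => s * c) (th_rel k0); rewrite mulr0 => <-.
  have e1 : -1 - (i - 1) = -1 - i + 1 by clear; lia.
  have e2 : -1 - (i + 1) = -1 - i - 1 by clear; lia.
  rewrite /tri (zneg (i - 1)); last by move: i0; clear; lia.
  rewrite (zneg i)// e1 center_left//; last by move: i0; clear; lia.
  rewrite center_left// e1.
  (* Site -1 is coupled to site 0, where [z] is 0; this matches the relation for [th] at index 0,
     whose term in [th (-1)] vanishes. *)
  have [i1|i1] := eqVneq i (-1).
    by rewrite i1 z0 /= thm1; rewrite (_ : -1 - -1 = 0)//; ring.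
  have i10 : i + 1 < 0 by move: i0 i1; clear; lia.
  by rewrite zneg// center_left// e2; ring.
have [->|i1] := eqVneq i 0.
  rewrite /tri z0 zneg// zpos// /center /toeplitz /= /s /t.
  by rewrite (_ : _ - -1 = 0)//; rewrite /zext /=; ring.
have {i0 i1} i0 : 1 <= i by move: i0 i1; clear; lia.
have := congr1 (fun f => t * (f (i - 1) : Cplx R)) (glue_ker Bx).
have -> : t * (((w * (x 0%N : Cplx R)) *: delta R (-1)) (i - 1) : Cplx R) = 0.
  change (t * (w * (x 0%N : Cplx R) * (i - 1 == -1)%:R) = 0).
  have -> : (i - 1 == -1) = false by move: i0; clear; lia.
  by rewrite !mulr0.
have i2 : 1 <= i + 1 by move: i0; clear; lia.
move=> <-; rewrite /tri (center_right i0 i0) (center_right i0 i2).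
rewrite (zpos i); last by move: i0; clear; lia.
rewrite (zpos (i + 1)); last by move: i0; clear; lia.
have -> : i + 1 - 1 = i - 1 + 1 by clear; lia.
(* Site 1 is coupled to site 0, where [z] vanishes, just as [zext x] does at -1. *)
have [i1|i1] := eqVneq i 1; last first.
  rewrite center_right//; last by move: i0 i1; clear; lia.
  by rewrite zpos; [ring|move: i0 i1; clear; lia].
by rewrite i1 z0 /= /zext /=; ring.
Qed.

End Coburn.

Theorem theorem2p2 (R : realType) (p : \bar R) (hp : (1 <= p)%E)
    (U V W : set (Cplx R))
    (U0 : U !=set0) (V0 : V !=set0) (W0 : W !=set0)
    (Uc : compact U) (Vc : compact V) (Wc : compact W) :
  compatible U V W p ->
  forall B : nat -> nat -> Cplx R, Mplus U V W B ->
    fredholm p (mxop B) /\ (alpha p (mxop B) = 0%E \/ beta p (mxop B) = 0%E).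
Proof.
move=> comp B MB; have inv := compatible_invertible hp Uc Vc Wc comp.
(* One element of each set provides the constant diagonals of the filler. *)
have [u Uu] := U0; have [v Vv] := V0; have [w Ww] := W0.
have [S bS hS] := inv _ (glue_M Uu Vv Ww MB); split.
  exact: (half_fredholm hp MB bS hS).
exact: (coburn hp Uu Vv Ww Uc Vc Wc inv MB bS hS).
Qed.
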